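(* For any fixed $k\ge 2$, \textsc{Maximum Rainbow $k$-Coloring} parameterized by $q$ is fixed-parameter tractable and can be solved deterministically in time $2^{O(q\log q)}n^{O(1)}$ and polynomial space, where $n$ is the number of vertices. For $k=2$ it can be solved in time $8^q n^{O(1)}$.
   Context: A path is rainbow if its edges have pairwise different colors. \textsc{Maximum Rainbow $k$-Coloring}: given a graph $G=(V,E)$ and an integer $q$, decide whether there is a coloring of $E$ with $k$ colors such that at least $q$ anti-edges (pairs of distinct non-adjacent vertices) are connected by a rainbow path. *)

(* Defs.v *)
From mathcomp Require Import all_boot.

Set Implicit Arguments.
Unset Strict Implicit.
Unset Printing Implicit Defensive.

(** * Random access machines with logarithmic cost

    Programs are structured RAM programs.  The directly addressed registers and
    the indirectly addressed memory hold natural numbers of arbitrary size; both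
    are zero outside the listed cells. *)

Inductive binop := Add | Sub | Mul | Div.

Inductive expr :=
  | Const of nat
  | Reg of nat
  | Mem of expr
  | Bin of binop & expr & expr.

Inductive com :=
  | Skip
  | Assign of nat & expr
  | Store of expr & expr
  | Seq of com & com
  | If of expr & com & com
  | While of expr & com.

Record state := State { regs : seq nat; memory : seq nat }.

(* Number of binary digits, with bitlen 0 = 1. *)
Definition bitlen (a : nat) : nat := (trunc_log 2 a).+1.

(* Truncated subtraction; division by zero yields zero. *)
Definition binop_eval (o : binop) : nat -> nat -> nat :=
  match o with Add => addn | Sub => subn | Mul => muln | Div => divn end.

(* Schoolbook bit costs. *)
Definition binop_cost (o : binop) (a b : nat) : nat :=
  match o with
  | Add | Sub => bitlen a + bitlen b
  | Mul | Div => bitlen a * bitlen b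
  end.

Fixpoint eval (s : state) (e : expr) : nat :=
  match e with
  | Const a => a
  | Reg i => nth 0 (regs s) i
  | Mem e1 => nth 0 (memory s) (eval s e1)
  | Bin o e1 e2 => binop_eval o (eval s e1) (eval s e2)
  end.

Fixpoint eval_cost (s : state) (e : expr) : nat :=
  match e with
  | Const a => bitlen a
  | Reg i => bitlen i + bitlen (eval s e)
  | Mem e1 => eval_cost s e1 + bitlen (eval s e1) + bitlen (eval s e)
  | Bin o e1 e2 =>
      eval_cost s e1 + eval_cost s e2 + binop_cost o (eval s e1) (eval s e2)
  end.

Definition assign (s : state) (i a : nat) : state :=
  State (set_nth 0 (regs s) i a) (memory s).

Definition store (s : state) (i a : nat) : state :=
  State (regs s) (set_nth 0 (memory s) i a).

(* Every cell below the largest address written so far is charged, used or not;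
   hence no space can be saved by scattering data over huge addresses. *)
Definition state_space (s : state) : nat :=
  \sum_(a <- regs s ++ memory s) bitlen a.

(* exec c s t m s': started in s, the program c halts in s' after time t, and m
   is the largest space of a state met on the way. *)
Inductive exec : com -> state -> nat -> nat -> state -> Prop :=
  | ExecSkip s : exec Skip s 1 (state_space s) s
  | ExecAssign i e s (s' := assign s i (eval s e)) :
      exec (Assign i e) s
        (eval_cost s e + bitlen i + bitlen (eval s e))
        (maxn (state_space s) (state_space s')) s'
  | ExecStore e1 e2 s (s' := store s (eval s e1) (eval s e2)) :
      exec (Store e1 e2) s
        (eval_cost s e1 + eval_cost s e2
         + bitlen (eval s e1) + bitlen (eval s e2))
        (maxn (state_space s) (state_space s')) s'
  | ExecSeq c1 c2 s1 s2 s3 t1 t2 m1 m2 :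
      exec c1 s1 t1 m1 s2 -> exec c2 s2 t2 m2 s3 ->
      exec (Seq c1 c2) s1 (t1 + t2) (maxn m1 m2) s3
  | ExecIf e c1 c2 s s' t m :
      exec (if eval s e != 0 then c1 else c2) s t m s' ->
      exec (If e c1 c2) s (eval_cost s e + bitlen (eval s e) + t) m s'
  | ExecWhileStop e c s :
      eval s e = 0 ->
      exec (While e c) s
        (eval_cost s e + bitlen (eval s e)) (state_space s) s
  | ExecWhileStep e c s1 s2 s3 t1 t2 m1 m2 :
      eval s1 e <> 0 ->
      exec c s1 t1 m1 s2 -> exec (While e c) s2 t2 m2 s3 ->
      exec (While e c) s1
        (eval_cost s1 e + bitlen (eval s1 e) + t1 + t2) (maxn m1 m2) s3.

Lemma exec_deterministic c s t m s' t2 m2 s2 :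
  exec c s t m s' -> exec c s t2 m2 s2 -> [/\ t = t2, m = m2 & s' = s2].
Proof.
move=> H; elim: H t2 m2 s2 => {c s t m s'}.
- by move=> s t m s' H; inversion H.
- by move=> i e s s' t m s2 H; inversion H.
- by move=> e1 e2 s s' t m s2 H; inversion H.
- move=> c1 c2 s1 s2 s3 t1 t2 m1 m2 _ IH1 _ IH2 t m s H; inversion H; subst; clear H.
  match goal with E : exec c1 _ _ _ _ |- _ => have [? ? ?] := IH1 _ _ _ E end.
  subst.
  match goal with E : exec c2 _ _ _ _ |- _ => have [? ? ?] := IH2 _ _ _ E end.
  by subst.
- move=> e c1 c2 s s' t m _ IH t2 m2 s2 H; inversion H; subst; clear H.
  match goal with E : exec _ _ _ _ _ |- _ => have [? ? ?] := IH _ _ _ E end.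
  by subst.
- by move=> e c s e0 t m s' H; inversion H.
- move=> e c s1 s2 s3 t1 t2 m1 m2 e0 _ IH1 _ IH2 t m s H.
  inversion H; subst => //; clear H.
  match goal with E : exec c _ _ _ _ |- _ => have [? ? ?] := IH1 _ _ _ E end.
  subst.
  match goal with
    E : exec (While _ _) _ _ _ _ |- _ => have [? ? ?] := IH2 _ _ _ E
  end.
  by subst.
Qed.

(* The input is the initial memory; the output is left in register 0. *)
Definition start (w : seq nat) : state := State [::] w.
Definition output (s : state) : nat := nth 0 (regs s) 0.

Definition computable (f : nat -> nat) : Prop :=
  exists P : com, forall a : nat, exists t m s,
    exec P (start [:: a]) t m s /\ output s = f a.

(** * Parameterized problems *)

Record parameterized_problem := ParameterizedProblem {
  instance_of : Type;
  encode : instance_of -> seq nat;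
  parameter : instance_of -> nat;
  yes_instance : instance_of -> Prop
}.

Definition input_size (A : parameterized_problem) (x : instance_of A) : nat :=
  \sum_(a <- encode x) bitlen a.

(* P halts on every instance x with the right answer, its time t and space m
   satisfying bound x t m. *)
Definition solves_within (A : parameterized_problem) (P : com)
    (bound : instance_of A -> nat -> nat -> Prop) : Prop :=
  forall x : instance_of A, exists t m s,
    [/\ exec P (start (encode x)) t m s,
        output s <> 0 <-> yes_instance x
      & bound x t m].

Definition fixed_parameter_tractable (A : parameterized_problem) : Prop :=
  exists (P : com) (f : nat -> nat) (c : nat),
    computable f /\
    solves_within (A := A) P
      (fun x t _ => t <= f (parameter x) * input_size x ^ c).

Definition is_bigO (f g : nat -> nat) : Prop :=
  exists c N : nat, forall a, N <= a -> f a <= c * g a.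

Definition polynomially_bounded (p : nat -> nat) : Prop :=
  exists c : nat, forall a, p a <= a ^ c + c.

(** * Rainbow colorings *)

Record sgraph (n : nat) := SGraph {
  adj : rel 'I_n;
  adj_sym : symmetric adj;
  adj_irrefl : irreflexive adj
}.

(* Unordered pairs, represented as two-element sets. *)
Definition anti_edges (n : nat) (G : sgraph n) : {set {set 'I_n}} :=
  [set [set uv.1; uv.2] | uv : 'I_n * 'I_n
     & (uv.1 != uv.2) && ~~ adj G uv.1 uv.2].

(* The edge {x, y} has color col [set x; y]; the values of col on sets that are
   not edges play no role. *)
Definition edge_colors (n k : nat) (col : {set 'I_n} -> 'I_k)
    (u : 'I_n) (p : seq 'I_n) : seq 'I_k :=
  pairmap (fun x y => col [set x; y]) u p.

Definition rainbow_connected (n k : nat) (G : sgraph n)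
    (col : {set 'I_n} -> 'I_k) (u v : 'I_n) : Prop :=
  exists p : seq 'I_n,
    [/\ path (adj G) u p, last u p = v, uniq (u :: p)
      & uniq (edge_colors col u p)].

Record rainbow_instance := RainbowInstance {
  order_of : nat;
  graph_of : sgraph order_of;
  target : nat
}.

Definition has_rainbow_coloring (k : nat) (x : rainbow_instance) : Prop :=
  exists (col : {set 'I_(order_of x)} -> 'I_k)
         (S : {set {set 'I_(order_of x)}}),
    [/\ S \subset anti_edges (graph_of x),
        target x <= #|S|
      & forall u v, [set u; v] \in S ->
          rainbow_connected (graph_of x) col u v].

(* n, q, then the adjacency matrix row by row. *)
Definition encode_rainbow (x : rainbow_instance) : seq nat :=
  [:: order_of x, target x &
    [seq nat_of_bool (adj (graph_of x) i j)
      | i <- enum 'I_(order_of x), j <- enum 'I_(order_of x)]].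

Definition max_rainbow_coloring (k : nat) : parameterized_problem :=
  {| instance_of := rainbow_instance;
     encode := encode_rainbow;
     parameter := target;
     yes_instance := has_rainbow_coloring k |}.

(* Main.v *)
(** A rainbow path with [k] colors has at most [k] edges, so a solution is
    witnessed by the colors of at most [2 k q] edges (two paths for each of [q]
    pairs).  For some modulus [p] polynomial in [q] and [log n] these edges have
    distinct codes modulo [p]; otherwise the product of the differences of codes
    would be a multiple of a binomial coefficient exceeding it.  It suffices to
    try every list of [2 k q] pairs (residue, color) for every such [p], which
    makes [(q log n)^O(q)] colorings, and [x ^ s <= s ^ s * 2 ^ x] turns
    [(log n)^O(q)] into [2^O(q log q) n^O(1)].

    For [k = 2] let [A] be the number of anti-edges at distance two.  A random
    coloring satisfies half of them, so we may assume [A < 2 q].  The colorings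
    leaving a given set of anti-edges unsatisfied are those constant on the
    classes of an equivalence of edges, hence there are [2^c] of them for [c]
    classes.  Inclusion and exclusion over the [2^A < 4^q] sets yields the sum over
    all colorings [f] of [y ^ sat f], where [y] exceeds the number of colorings;
    this sum is at least [y ^ q] exactly if some [f] satisfies [q] anti-edges.

    Programs are compiled from terms with bounded iteration, which are evaluated
    in registers only, so that space is polynomial as soon as all values are. *)

Require Import Defs.
From mathcomp Require Import all_boot all_algebra zify ring.

Set Implicit Arguments.
Unset Strict Implicit.
Unset Printing Implicit Defensive.

(** * Compiling terms to random access machines *)

(** Costs being logarithmic, a step count alone bounds nothing: every intermediate number needs a
    bound on its bits. The analysis fixes one register width, the bits of the target plus a
    polynomial in n, and charges each step a multiple of the squared width. The step count may be
    superpolynomial in one way only, through loops of [T] rounds that are never nested in each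
    other; all other loops run polynomially often in n. This is why small and big loops are told
    apart throughout. Since terms use no writable memory, tables, labellings and sets of pairs are
    single numbers whose digits are extracted by division. A family of moduli suits this setting:
    hashing is one remainder, and since arbitrary moduli are allowed, neither primality tests nor
    estimates on the density of primes are involved. The machine knows no negative numbers, so the
    alternating sum for two colors is kept as two sums of natural numbers that are compared at the
    end; only its proof passes to the integers. *)

Lemma bitlen_le a b : 0 < b -> (bitlen a <= b) = (a < 2 ^ b).
Proof.
move=> b_gt0; rewrite /bitlen; case: (posnP a) => [->|a_gt0].
  by rewrite trunc_log0 b_gt0 expn_gt0.
apply/idP/idP => [lab|ltab].
  by apply: leq_trans (@trunc_log_ltn 2 a isT) _; rewrite leq_exp2l.
by rewrite -(ltn_exp2l (m := 2)) //; apply: leq_ltn_trans (trunc_logP _ _) ltab.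
Qed.

Lemma ltn_bitlen a : a < 2 ^ bitlen a.
Proof. by rewrite -bitlen_le. Qed.

Lemma bitlen_mono a b : a <= b -> bitlen a <= bitlen b.
Proof. by move=> ab; rewrite /bitlen ltnS leq_trunc_log. Qed.

Lemma bitlen_binop o a b : bitlen (binop_eval o a b) <= bitlen a + bitlen b.
Proof.
have ltab : a * b < 2 ^ (bitlen a + bitlen b).
  rewrite expnD; have /= := ltn_bitlen a; have /= := ltn_bitlen b; nia.
case: o => /=; last 2 first.
- by rewrite bitlen_le // addn_gt0.
- by apply: leq_trans (bitlen_mono (leq_div a b)) _; rewrite leq_addr.
- rewrite bitlen_le ?addn_gt0 // expnD.
  have := ltn_bitlen a; have := ltn_bitlen b.
  have := ltn_expl (bitlen a) (isT : 1 < 2); have := ltn_expl (bitlen b) (isT : 1 < 2).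
  rewrite /bitlen; nia.
- by apply: leq_trans (bitlen_mono (leq_subr b a)) _; rewrite leq_addr.
Qed.

(** * Cost measures of programs *)

Fixpoint expr_width (e : expr) : nat :=
  match e with
  | Const a => bitlen a
  | Reg _ | Defs.Mem _ => 1
  | Bin _ e1 e2 => expr_width e1 + expr_width e2
  end.

(** The unit is the squared register width, because a product or quotient costs the product of the
    lengths of its operands; [expr_width] counts lengths in units of the width itself. *)
Fixpoint expr_cost (e : expr) : nat :=
  match e with
  | Const a => bitlen a
  | Reg i => bitlen i + 1
  | Defs.Mem e1 => expr_cost e1 + expr_width e1 + 1
  | Bin _ e1 e2 =>
      expr_cost e1 + expr_cost e2
      + (expr_width e1 + expr_width e2 + expr_width e1 * expr_width e2)
  end.

(* Bounds the time of a program, in units of the squared register width, when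
   every loop makes at most [L] iterations; if [big] holds, loops of up to [T]
   iterations are allowed too, provided that they are not nested. *)
Fixpoint com_cost (L T : nat) (big : bool) (c : com) : nat :=
  match c with
  | Skip => 1
  | Assign i e => expr_cost e + bitlen i + expr_width e
  | Store e1 e2 => expr_cost e1 + expr_cost e2 + expr_width e1 + expr_width e2
  | Seq c1 c2 => com_cost L T big c1 + com_cost L T big c2
  | If e c1 c2 =>
      expr_cost e + expr_width e + com_cost L T big c1 + com_cost L T big c2
  | While e c1 =>
      let g := expr_cost e + expr_width e in
      g + L * (g + com_cost L T big c1)
      + (if big then T * (g + com_cost L T false c1) else 0)
  end.

Fixpoint reg_count (c : com) : nat :=
  match c with
  | Assign i _ => i.+1
  | Seq c1 c2 | If _ c1 c2 => maxn (reg_count c1) (reg_count c2)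
  | While _ c1 => reg_count c1
  | _ => 0
  end.

Lemma com_cost_big L T c : com_cost L T false c <= com_cost L T true c.
Proof.
elim: c => //= [c1 IH1 c2 IH2|e c1 IH1 c2 IH2|e c IH]; try by lia.
by rewrite addn0; apply: leq_trans (leq_addr _ _); rewrite leq_add2l leq_mul2l leq_add2l IH orbT.
Qed.

(** The coefficient in [com_cost_le]. In a loop the factor 3 pays for the guard in the final test,
    in the small rounds and in the big rounds; the factor 2 pays for the body in a small and in a
    big loop. *)
Fixpoint com_size (c : com) : nat :=
  match c with
  | Skip => 1
  | Assign i e => expr_cost e + bitlen i + expr_width e
  | Store e1 e2 => expr_cost e1 + expr_cost e2 + expr_width e1 + expr_width e2
  | Seq c1 c2 => com_size c1 + com_size c2
  | If e c1 c2 => expr_cost e + expr_width e + com_size c1 + com_size c2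
  | While e c1 => 3 * (expr_cost e + expr_width e) + 2 * com_size c1
  end.

Fixpoint com_depth (c : com) : nat :=
  match c with
  | Seq c1 c2 | If _ c1 c2 => maxn (com_depth c1) (com_depth c2)
  | While _ c1 => (com_depth c1).+1
  | _ => 0
  end.

(** Small loops nest, and each level contributes a factor [L]; [T] enters only linearly because the
    body of a big loop is charged with [big] switched off. *)
Lemma com_cost_le L T big c : 0 < L -> 0 < T ->
  com_cost L T big c <= com_size c * L ^ com_depth c * (if big then T else 1).
Proof.
move=> L0 T0; elim: c big => [|i e|e1 e2|c1 IH1 c2 IH2|e c1 IH1 c2 IH2|e c IH] big /=.
- by case: big; lia.
- by case: big; rewrite expn0; nia.
- by case: big; rewrite expn0; nia.
- have := IH1 big; have := IH2 big.
  have := leq_pexp2l L0 (leq_maxl (com_depth c1) (com_depth c2)).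
  have := leq_pexp2l L0 (leq_maxr (com_depth c1) (com_depth c2)).
  case: big; nia.
- have := IH1 big; have := IH2 big.
  have := leq_pexp2l L0 (leq_maxl (com_depth c1) (com_depth c2)).
  have := leq_pexp2l L0 (leq_maxr (com_depth c1) (com_depth c2)).
  have := expn_gt0 L (maxn (com_depth c1) (com_depth c2)); rewrite L0.
  have : 0 < (if big then T else 1) by case: big.
  set h := if big then T else 1 => h0.
  set a := _ ^ maxn _ _; set a1 := _ ^ com_depth c1; set a2 := _ ^ com_depth c2.
  move=> a0 l2 l1 i2 i1.
  have : com_size c1 * a1 * h <= com_size c1 * a * h by nia.
  have : com_size c2 * a2 * h <= com_size c2 * a * h by nia.
  have ah : 0 < a * h by rewrite muln_gt0 a0.
  have := leq_pmulr (expr_cost e + expr_width e) ah.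
  rewrite -!mulnA !mulnDl; lia.
- have := IH true; have := IH false; rewrite muln1 expnS.
  have := expn_gt0 L (com_depth c); rewrite L0 /=.
  set a := L ^ _; set g := _ + expr_width e; set z := com_size c.
  move=> a0 i0 i1; have := com_cost_big L T c.
  set f := com_cost _ _ false _ in i0 *; set t := com_cost _ _ true _ in i1 *.
  move=> ft; case: big.
    have La : L <= L * a * T by rewrite -mulnA leq_pmulr // muln_gt0 a0.
    have Ta : T <= L * a * T by rewrite leq_pmull // muln_gt0 L0.
    have h1 : g <= g * (L * a * T) by rewrite leq_pmulr // (leq_trans L0).
    have h2 : L * g <= g * (L * a * T) by rewrite mulnC leq_mul2l La orbT.
    have h3 : T * g <= g * (L * a * T) by rewrite mulnC leq_mul2l Ta orbT.
    have h4 : L * t <= z * (L * a * T).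
      by rewrite -mulnA (mulnCA z) leq_mul2l (mulnA z) i1 orbT.
    have h5 : T * f <= z * (L * a * T).
      rewrite (mulnC _ T) (mulnCA z) leq_mul2l; apply/orP; right.
      by apply: leq_trans i0 _; rewrite leq_mul2l leq_pmull ?orbT.
    by lia.
  have h0 : L <= L * a by rewrite leq_pmulr.
  have h1 : g <= g * (L * a) by rewrite leq_pmulr // (leq_trans L0).
  have h2 : L * g <= g * (L * a) by rewrite mulnC leq_mul2l h0 orbT.
  have h4 : L * f <= z * (L * a) by rewrite (mulnCA z) leq_mul2l i0 orbT.
  by lia.
Qed.

(** The parameters of the analysis of one run: the input, the bit length that all register values
    must respect, and the two loop limits of [com_cost]. The program itself never sees the last
    three. *)
Record machine := Machine {
  input : seq nat;
  width : nat;
  small_limit : nat;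
  big_limit : nat;
  width_gt0 : 0 < width;
  input_lt : all (fun a => a < 2 ^ width) input
}.

Section Compiler.

Variable M : machine.
Local Notation w := (input M).
Local Notation b := (width M).
Local Notation L := (small_limit M).
Local Notation T := (big_limit M).

Let b_gt0 : 0 < b. Proof. exact: width_gt0. Qed.
Let w_lt : all (fun a => a < 2 ^ b) w. Proof. exact: input_lt. Qed.

(** Compiled terms contain no [Store], so the memory remains the input throughout and only the
    registers need watching. *)
Definition good R s :=
  [/\ memory s = w, size (regs s) <= R & all (fun a => a < 2 ^ b) (regs s)].

Lemma nth_lt r i : all (fun a => a < 2 ^ b) r -> nth 0 r i < 2 ^ b.
Proof.
move=> rP; case: (ltnP i (size r)) => ir; first exact: (all_nthP 0 rP).
by rewrite nth_default ?expn_gt0.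
Qed.

Lemma good_space R s : good R s -> state_space s <= b * (R + size w).
Proof.
case=> ms sR rP; rewrite /state_space ms.
have aP : all (fun a => a < 2 ^ b) (regs s ++ w) by rewrite all_cat rP.
apply: (@leq_trans (b * size (regs s ++ w))); last first.
  by rewrite size_cat leq_mul2l leq_add2r sR orbT.
elim: (_ ++ _) aP => [|a r IH] /=; first by rewrite big_nil.
by case/andP=> aP rPr; rewrite big_cons mulnS leq_add ?IH // bitlen_le.
Qed.

Lemma eval_width R s e : good R s -> bitlen (eval s e) <= expr_width e * b.
Proof.
case=> ms sR rP; elim: e => [a|i|e IH|o e1 IH1 e2 IH2] /=.
- by rewrite leq_pmulr.
- by rewrite mul1n bitlen_le ?nth_lt.
- by rewrite mul1n bitlen_le // ms nth_lt.
- by apply: leq_trans (bitlen_binop _ _ _) _; rewrite mulnDl leq_add.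
Qed.

Lemma eval_cost_le R s e : good R s -> eval_cost s e <= expr_cost e * b ^ 2.
Proof.
move=> gs; have b2 : b <= b ^ 2 by rewrite -mulnn leq_pmulr.
elim: e => [a|i|e IH|o e1 IH1 e2 IH2] /=.
- by rewrite leq_pmulr // expn_gt0 b_gt0.
- have := eval_width (Reg i) gs; rewrite /= mul1n; nia.
- have := eval_width e gs; have := eval_width (Defs.Mem e) gs => /=; nia.
- have := eval_width e1 gs; have := eval_width e2 gs.
  have h : binop_cost o (eval s e1) (eval s e2) <=
    bitlen (eval s e1) + bitlen (eval s e2) + bitlen (eval s e1) * bitlen (eval s e2).
    by case: o => /=; lia.
  move: h IH1 IH2; set x := binop_cost _ _ _; set x1 := bitlen _; set x2 := bitlen _.
  set w1 := expr_width e1; set w2 := expr_width e2 => h i1 i2 l2 l1.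
  have h1 : x1 * x2 <= w1 * w2 * b ^ 2 by rewrite -mulnn; nia.
  have h2 : w1 * b <= w1 * b ^ 2 by nia.
  have h3 : w2 * b <= w2 * b ^ 2 by nia.
  nia.
Qed.

Definition runs R C c s s' :=
  exists t m, [/\ exec c s t m s', t <= C * b ^ 2 & m <= b * (R + size w)].

Lemma good_assign R s i a :
  good R s -> i < R -> a < 2 ^ b -> good R (assign s i a).
Proof.
case=> ms sR rP iR aP; split=> //=; first by rewrite size_set_nth geq_max iR.
rewrite all_count count_set_nth size_set_nth aP expn_gt0 /= mul1n.
have := nth_lt i rP; move: rP; rewrite all_count => /eqP -> ->; lia.
Qed.

Lemma runs_assign R s i e : good R s -> i < R -> eval s e < 2 ^ b ->
  runs R (com_cost L T false (Assign i e)) (Assign i e) s (assign s i (eval s e)).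
Proof.
move=> gs iR eP; exists (eval_cost s e + bitlen i + bitlen (eval s e)).
exists (maxn (state_space s) (state_space (assign s i (eval s e)))).
split; first exact: ExecAssign.
  have b2 : b <= b ^ 2 by rewrite -mulnn leq_pmulr.
  rewrite /= !mulnDl !leq_add ?(eval_cost_le _ gs) //.
    by rewrite leq_pmulr // expn_gt0 b_gt0.
  by apply: leq_trans (eval_width e gs) _; rewrite leq_mul2l b2 orbT.
by rewrite geq_max !good_space //; apply: good_assign.
Qed.

Lemma runs_seq R C1 C2 c1 c2 s1 s2 s3 :
  runs R C1 c1 s1 s2 -> runs R C2 c2 s2 s3 -> runs R (C1 + C2) (Seq c1 c2) s1 s3.
Proof.
move=> [t1 [m1 [x1 lt1 lm1]]] [t2 [m2 [x2 lt2 lm2]]].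
exists (t1 + t2), (maxn m1 m2); split; first exact: ExecSeq x1 x2.
  by rewrite mulnDl leq_add.
by rewrite geq_max lm1.
Qed.

(** The invariant is indexed by the number of completed rounds and the guard evaluates to the number
    of rounds left, so the loop stops exactly after [N] rounds. *)
Lemma runs_while R C e c (I : nat -> state -> Prop) N s :
  (forall i s, i <= N -> I i s -> good R s /\ eval s e = N - i) ->
  (forall i s, i < N -> I i s -> exists s', runs R C c s s' /\ I i.+1 s') ->
  I 0 s ->
  exists s', runs R (expr_cost e + expr_width e
                     + N * (expr_cost e + expr_width e + C)) (While e c) s s'
             /\ I N s'.
Proof.
move=> gI step; set g := _ + expr_width e.
have gP i s0 : i <= N -> I i s0 -> eval_cost s0 e + bitlen (eval s0 e) <= g * b ^ 2.
  move=> iN Is; have [gs _] := gI i s0 iN Is; rewrite mulnDl leq_add ?(eval_cost_le _ gs) //.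
  apply: leq_trans (eval_width e gs) _; rewrite leq_mul2l -mulnn.
  by rewrite leq_pmulr ?orbT.
suff H k i s0 : i + k = N -> I i s0 ->
    exists s', runs R (g + k * (g + C)) (While e c) s0 s' /\ I N s'.
  by move=> I0; apply: (H N 0).
elim: k i s0 => [|k IH] i s0 ik Is.
  rewrite addn0 in ik; subst i; have [gs ev] := gI N s0 (leqnn N) Is.
  exists s0; split=> //; exists (eval_cost s0 e + bitlen (eval s0 e)), (state_space s0).
  split; last exact: good_space.
    by apply: ExecWhileStop; rewrite ev subnn.
  by rewrite mul0n addn0 (gP N).
have iN : i < N by rewrite -ik addnS ltnS leq_addr.
have [gs ev] := gI i s0 (ltnW iN) Is.
have [s1 [[t1 [m1 [x1 lt1 lm1]]] I1]] := step i s0 iN Is.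
have [|s2 [[t2 [m2 [x2 lt2 lm2]]] I2]] := IH i.+1 s1 _ I1; first by rewrite -ik addSnnS.
exists s2; split=> //.
exists (eval_cost s0 e + bitlen (eval s0 e) + t1 + t2), (maxn m1 m2); split.
- by apply: ExecWhileStep x1 x2; rewrite ev; lia.
- have := gP i s0 (ltnW iN) Is; rewrite mulSn; nia.
- by rewrite geq_max lm1.
Qed.

(* A term is compiled at a depth [d]: its code leaves the value in register [d]
   and preserves the registers below [d], which hold the bound variables. *)
Definition term := nat -> com.

Definition agree (env : seq nat) (s : state) :=
  forall i, i < size env -> nth 0 (regs s) i = nth 0 env i.

(* Quantifying over all extensions of the environment makes weakening
   immediate, so that terms may be built by higher-order abstract syntax. *)
Definition comp (big : bool) (env : seq nat) (a : term) (v : nat) : Prop :=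
  v < 2 ^ b /\
  forall (env' : seq nat) R s, prefix env env' -> good R s -> agree env' s ->
    reg_count (a (size env')) <= R ->
    exists s', [/\ runs R (com_cost L T big (a (size env'))) (a (size env')) s s',
                   good R s' & agree (rcons env' v) s'].

Lemma comp_lt big env a v : comp big env a v -> v < 2 ^ b.
Proof. by case. Qed.

Lemma comp_weaken big env env' a v :
  prefix env env' -> comp big env a v -> comp big env' a v.
Proof.
move=> pe [vP H]; split=> // e R s pe'; apply: H; exact: prefix_trans pe pe'.
Qed.

Lemma runs_weaken R C C' c s s' : C <= C' -> runs R C c s s' -> runs R C' c s s'.
Proof.
move=> CC' [t [m [x lt lm]]]; exists t, m; split=> //.
by apply: leq_trans lt _; rewrite leq_mul2r CC' orbT.
Qed.

Lemma comp_big big env a v : comp false env a v -> comp big env a v.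
Proof.
case: big => // -[vP H]; split=> // e R s pe gs ag rR.
have [s' [h1 h2 h3]] := H e R s pe gs ag rR; exists s'; split=> //.
exact: runs_weaken (com_cost_big _ _ _) h1.
Qed.

Lemma agree_assign env s v : agree env s -> agree (rcons env v) (assign s (size env) v).
Proof.
move=> ag i; rewrite size_rcons ltnS nth_set_nth /= nth_rcons => iE.
by case: ltngtP iE => // iE _; rewrite ag.
Qed.

Lemma agree_rcons env v s : agree (rcons env v) s -> agree env s.
Proof.
move=> ag i iE; rewrite ag ?size_rcons ?ltnS ?(ltnW iE) //.
by rewrite nth_rcons iE.
Qed.

Lemma agree_last env v s : agree (rcons env v) s -> nth 0 (regs s) (size env) = v.
Proof. by move=> ag; rewrite ag ?size_rcons // nth_rcons ltnn eqxx. Qed.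

Lemma comp_assign big env (e : nat -> expr) v : v < 2 ^ b ->
  (forall (env' : seq nat) R s, prefix env env' -> good R s -> agree env' s ->
     eval s (e (size env')) = v) ->
  comp big env (fun d => Assign d (e d)) v.
Proof.
move=> vP ev; apply: comp_big; split=> // env' R s pe gs ag rR.
have evs := ev env' R s pe gs ag; exists (assign s (size env') v); split.
- by rewrite -evs; apply: runs_assign => //; rewrite evs.
- exact: good_assign.
- exact: agree_assign.
Qed.

(** * Term constructors and their compilation rules *)

Definition cst (a : nat) : term := fun d => Assign d (Const a).
Definition var (i : nat) : term := fun d => Assign d (Reg i).

Definition load (a : term) : term :=
  fun d => Seq (a d) (Assign d (Defs.Mem (Reg d))).

Definition op (o : binop) (a1 a2 : term) : term :=
  fun d => Seq (a1 d) (Seq (a2 d.+1) (Assign d (Bin o (Reg d) (Reg d.+1)))).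

(** The bound variable is the term [var d], which copies register [d]; the body is compiled one
    level deeper, so the value of [a] is computed once however often it is used. *)
Definition lett (a : term) (f : term -> term) : term :=
  fun d => Seq (a d) (Seq (f (var d) d.+1) (Assign d (Reg d.+1))).

(** Register layout of a loop at depth [d]: the number of rounds in [d], the accumulator in [d.+1],
    the counter in [d.+2], scratch space from [d.+3] on. *)
Definition iter_body (d : nat) (f : term -> term -> term) : com :=
  Seq (f (var d.+2) (var d.+1) d.+3)
    (Seq (Assign d.+1 (Reg d.+3)) (Assign d.+2 (Bin Add (Reg d.+2) (Const 1)))).

Definition iterate (n init : term) (f : term -> term -> term) : term :=
  fun d => Seq (n d) (Seq (init d.+1) (Seq (Assign d.+2 (Const 0))
    (Seq (While (Bin Defs.Sub (Reg d) (Reg d.+2)) (iter_body d f))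
         (Assign d (Reg d.+1))))).

Lemma comp_cst big env a : a < 2 ^ b -> comp big env (cst a) a.
Proof. by move=> aP; apply: (@comp_assign _ _ (fun=> Const a)). Qed.

Lemma comp_var big env i : i < size env -> nth 0 env i < 2 ^ b ->
  comp big env (var i) (nth 0 env i).
Proof.
move=> iE vP; apply: (@comp_assign _ _ (fun=> Reg i)) => // env' R s /prefixP [e ->] gs ag.
by rewrite /= ag ?nth_cat ?size_cat ?iE // ltn_addr.
Qed.

Lemma runs_set R s env d e v :
  good R s -> agree env s -> d < R -> d <= size env ->
  eval s e = v -> v < 2 ^ b ->
  [/\ runs R (com_cost L T false (Assign d e)) (Assign d e) s (assign s d v),
      good R (assign s d v) & agree (rcons (take d env) v) (assign s d v)].
Proof.
move=> gs ag dR dE ev vP; split.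
- by rewrite -ev; apply: runs_assign => //; rewrite ev.
- exact: good_assign.
- move=> i; rewrite size_rcons size_takel // ltnS nth_set_nth /= nth_rcons size_takel //.
  by case: ltngtP => // id _; rewrite ag ?nth_take //; apply: leq_trans id dE.
Qed.

Lemma agree_set env s d v : d <= size env -> agree env s ->
  agree (set_nth 0 env d v) (assign s d v).
Proof.
move=> dE ag i; rewrite size_set_nth !nth_set_nth /=; case: eqP => // /eqP id iE.
apply: ag; case: (ltngtP i d) id => // [id _|di _]; first exact: leq_trans id dE.
by move: iE; rewrite leq_max ltnS leqNgt di.
Qed.

Lemma comp_load big env a v : comp big env a v -> comp big env (load a) (nth 0 w v).
Proof.
move=> [vP H]; split=> [|env' R s pe gs ag /=]; first exact: nth_lt.
rewrite geq_max => /andP[aR dR].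
have [s1 [r1 g1 a1]] := H env' R s pe gs ag aR.
have [|||r2 g2 a2] := @runs_set R s1 (rcons env' v) (size env') (Defs.Mem (Reg (size env')))
  (nth 0 w v) g1 a1 dR => //; first by rewrite size_rcons.
- by rewrite /= (agree_last a1); case: g1 => ->.
- exact: nth_lt.
exists (assign s1 (size env') (nth 0 w v)); split=> //.
- exact: runs_seq r1 r2.
- by move: a2; rewrite -!cats1 take_size_cat.
Qed.

Lemma comp_op big env o a1 a2 v1 v2 : comp big env a1 v1 -> comp big env a2 v2 ->
  binop_eval o v1 v2 < 2 ^ b -> comp big env (op o a1 a2) (binop_eval o v1 v2).
Proof.
move=> [v1P H1] [v2P H2] vP; split=> // env' R s pe gs ag /=.
rewrite !geq_max => /and3P[R1 R2 dR].
have [s1 [r1 g1 ag1]] := H1 env' R s pe gs ag R1.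
have pe1 : prefix env (rcons env' v1) by apply: prefix_trans pe (prefix_rcons _ _).
have [|s2 [r2 g2 ag2]] := H2 (rcons env' v1) R s1 pe1 g1 ag1; first by rewrite size_rcons.
rewrite size_rcons in r2.
have [|||r3 g3 ag3] := @runs_set R s2 (rcons (rcons env' v1) v2) (size env')
  (Bin o (Reg (size env')) (Reg (size env').+1)) (binop_eval o v1 v2) g2 ag2 dR => //.
- by rewrite !size_rcons !leqW.
- have := agree_last ag2; rewrite size_rcons /= => ->.
  by rewrite (agree_last (agree_rcons ag2)).
exists (assign s2 (size env') (binop_eval o v1 v2)); split=> //.
  exact: runs_seq r1 (runs_seq r2 r3).
by move: ag3; rewrite -!cats1 -catA take_size_cat.
Qed.

Lemma comp_lett big env a f v vf : comp big env a v ->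
  (forall (env' : seq nat) x, prefix env env' -> comp false env' x v -> comp big env' (f x) vf) ->
  comp big env (lett a f) vf.
Proof.
move=> [vP H] Hf.
have vfP : vf < 2 ^ b.
  apply: (comp_lt (Hf (rcons env v) (var (size env)) _ _)); first exact: prefix_rcons.
  rewrite -[X in comp _ _ _ X](_ : nth 0 (rcons env v) (size env) = v).
    by apply: comp_var; rewrite ?size_rcons // nth_rcons ltnn eqxx.
  by rewrite nth_rcons ltnn eqxx.
split=> // env' R s pe gs ag /=; rewrite !geq_max => /and3P[R1 R2 dR].
have [s1 [r1 g1 ag1]] := H env' R s pe gs ag R1.
have pe1 : prefix env (rcons env' v) by apply: prefix_trans pe (prefix_rcons _ _).
have nv : nth 0 (rcons env' v) (size env') = v by rewrite nth_rcons ltnn eqxx.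
have cx : comp false (rcons env' v) (var (size env')) v.
  by rewrite -[X in comp _ _ _ X]nv; apply: comp_var; rewrite ?size_rcons // nv.
have [_ Hx] := Hf _ _ pe1 cx.
have [|s2 [r2 g2 ag2]] := Hx (rcons env' v) R s1 (prefix_refl _) g1 ag1.
  by rewrite size_rcons.
rewrite size_rcons in r2.
have [|||r3 g3 ag3] := @runs_set R s2 (rcons (rcons env' v) vf) (size env')
  (Reg (size env').+1) vf g2 ag2 dR => //.
- by rewrite !size_rcons !leqW.
- by have := agree_last ag2; rewrite size_rcons.
exists (assign s2 (size env') vf); split=> //.
  exact: runs_seq r1 (runs_seq r2 r3).
by move: ag3; rewrite -!cats1 -catA take_size_cat.
Qed.


Lemma comp_varE env v : v < 2 ^ b -> comp false (rcons env v) (var (size env)) v.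
Proof.
move=> vP; have nv : nth 0 (rcons env v) (size env) = v by rewrite nth_rcons ltnn eqxx.
by rewrite -[X in comp _ _ _ X]nv; apply: comp_var; rewrite ?size_rcons // nv.
Qed.

(** Either the loop is small and its body inherits the permission to contain big loops, or the loop
    is big and its body loses it. *)
Definition loop_bound (big big' : bool) (n : nat) :=
  n <= L /\ big' = big \/ [/\ n <= T, big' = false & big].

Lemma com_cost_while big big' e c n :
  loop_bound big big' n ->
  expr_cost e + expr_width e + n * (expr_cost e + expr_width e + com_cost L T big' c)
  <= com_cost L T big (While e c).
Proof.
rewrite [com_cost _ _ _ (While _ _)]/=; move: (_ + expr_width e) => g [[nL ->]|[nT -> bigT]].
  by rewrite -addnA leq_add2l; apply: leq_trans (leq_addr _ _); rewrite leq_mul2r nL orbT.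
by rewrite bigT -addnA leq_add2l; apply: leq_trans (leq_addl _ _); rewrite leq_mul2r nT orbT.
Qed.

Lemma comp_iterate big big' env n init f vn (F : nat -> nat) :
  loop_bound big big' vn ->
  comp big env n vn -> comp big env init (F 0) ->
  (forall i (env' : seq nat) x y, i < vn -> prefix env env' ->
     comp false env' x i -> comp false env' y (F i) ->
     comp big' env' (f x y) (F i.+1)) ->
  comp big env (iterate n init f) (F vn).
Proof.
move=> bound [vnP Hn] [F0P Hi] Hf.
(* That the accumulator always fits a register is part of [comp] for the body, here read off in an
   environment extended by an accumulator and a counter. *)
have FP i : i <= vn -> F i < 2 ^ b.
  elim: i => // i IH ivn; pose e := rcons (rcons env (F i)) i.
  have iP : i < 2 ^ b by apply: leq_trans (leqW ivn) _.
  apply: (comp_lt (Hf i e (var (size env).+1) (var (size env)) ivn _ _ _)).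
  - exact: prefix_trans (prefix_rcons _ _) (prefix_rcons _ _).
  - by rewrite -(size_rcons env (F i)); apply: comp_varE.
  - by apply: comp_weaken (prefix_rcons _ _) _; apply/comp_varE/IH/ltnW.
split=> [|env' R s pe gs ag]; first exact: FP.
rewrite [reg_count _]/= !geq_max => /and5P[nR iR d2R /and3P[fR d1R _] dR].
set d := size env' in nR iR d2R fR d1R dR *.
have [s1 [r1 g1 ag1]] := Hn env' R s pe gs ag nR.
have pe1 : prefix env (rcons env' vn) by apply: prefix_trans pe (prefix_rcons _ _).
have [|s2 [r2 g2 ag2]] := Hi (rcons env' vn) R s1 pe1 g1 ag1; first by rewrite size_rcons.
rewrite size_rcons in r2.
pose E i := rcons (rcons (rcons env' vn) (F i)) i.
have sE i : size (E i) = d.+3 by rewrite !size_rcons.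
have [||r3 g3 ag3] := @runs_set R s2 _ d.+2 (Const 0) 0 g2 ag2 d2R _ erefl.
- by rewrite !size_rcons.
- by rewrite expn_gt0.
have ag3' : agree (E 0) (assign s2 d.+2 0).
  by move: ag3; rewrite take_oversize // !size_rcons.
have [||s4 [r4 [g4 ag4]]] := @runs_while R (com_cost L T big' (iter_body d f))
  (Bin Defs.Sub (Reg d) (Reg d.+2))
  (iter_body d f) (fun i s => good R s /\ agree (E i) s) vn _ _ _ (conj g3 ag3').
- move=> i s0 _ [g0 a0]; split=> //=.
  have := agree_last (agree_rcons (agree_rcons a0)); have := agree_last a0.
  by rewrite !size_rcons -/d => -> ->.
- move=> i s0 ivn [g0 a0].
  have iP : i < 2 ^ b by apply: leq_trans (leqW ivn) _.
  have peE : prefix env (E i).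
    by do 3!apply: prefix_trans (prefix_rcons _ _); rewrite ?pe //.
  have [] := Hf i (E i) (var d.+2) (var d.+1) ivn peE.
  + have -> : d.+2 = size (rcons (rcons env' vn) (F i)) by rewrite !size_rcons.
    exact: comp_varE.
  + apply: comp_weaken (prefix_rcons _ _) _.
    have -> : d.+1 = size (rcons env' vn) by rewrite !size_rcons.
    exact/comp_varE/FP/ltnW.
  move=> FiP Hx; have [|s5 [r5 g5 ag5]] := Hx _ R s0 (prefix_refl _) g0 a0; first by rewrite sE.
  rewrite sE in r5.
  have ev5 : eval s5 (Reg d.+3) = F i.+1.
    by have := agree_last ag5; rewrite /= sE.
  have r6 := @runs_assign R s5 d.+1 (Reg d.+3) g5 d1R; rewrite ev5 in r6.
  have g6 := good_assign g5 d1R FiP.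
  have ag6 := @agree_set _ s5 d.+1 (F i.+1) _ ag5; rewrite !size_rcons in ag6.
  set s6 := assign s5 d.+1 _ in r6 g6 ag6.
  have ev6 : eval s6 (Bin Add (Reg d.+2) (Const 1)) = i.+1.
    have := agree_last (agree_rcons ag5); rewrite !size_rcons /= nth_set_nth /= => di.
    by rewrite gtn_eqF // di addn1.
  have i1P : i.+1 < 2 ^ b by apply: leq_ltn_trans ivn _.
  have r7 := @runs_assign R s6 d.+2 (Bin Add (Reg d.+2) (Const 1)) g6 d2R; rewrite ev6 in r7.
  have g7 := good_assign g6 d2R i1P.
  exists (assign s6 d.+2 i.+1); split; last split=> //.
    by apply: (runs_seq r5); apply: runs_seq; [exact: r6 | exact: r7].
  move=> j; rewrite sE => jd; rewrite /= !nth_set_nth /=.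
  have := agree_rcons (agree_rcons (agree_rcons ag5)).
  move=> /(_ j); rewrite !nth_rcons !size_rcons -/d.
  rewrite nth_set_nth /=; case: (ltngtP j d.+2) jd => [jd _|jd|//].
    by case: (ltngtP j d.+1) jd => [jd _ ->|jd|//]; rewrite // ltnNge => /negP[].
  by rewrite ltnS leqNgt jd.
have l4 := runs_weaken (com_cost_while (Bin Defs.Sub (Reg d) (Reg d.+2)) (iter_body d f) bound) r4.
have [|||r5 g5 ag5] := @runs_set R s4 _ d (Reg d.+1) (F vn) g4 ag4 dR.
- by rewrite sE !leqW.
- by have := agree_last (agree_rcons ag4); rewrite size_rcons.
- exact: FP.
exists (assign s4 d (F vn)); split=> //.
  exact: runs_seq r1 (runs_seq r2 (runs_seq r3 (runs_seq l4 r5))).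
by move: ag5; rewrite /E -!cats1 -!catA take_size_cat.
Qed.

Lemma comp_exec big a v : comp big [::] a v ->
  exists t m s, [/\ exec (a 0) (start w) t m s, output s = v,
    t <= com_cost L T big (a 0) * b ^ 2 & m <= b * (reg_count (a 0) + size w)].
Proof.
move=> [vP H].
have gs : good (reg_count (a 0)) (start w) by split.
have ag : agree [::] (start w) by [].
have [s [[t [m [x lt lm]]] _ ag']] := H [::] _ _ (prefix_refl _) gs ag (leqnn _).
by exists t, m, s; split=> //; apply: (agree_last ag').
Qed.

End Compiler.

(** * Arithmetic and logical terms *)

(** Truth values are the numbers 0 and 1; truncated subtraction from 1 negates them and also tests
    any number for zero, from which all comparisons below are built. *)
Definition notT (a : term) := op Defs.Sub (cst 1) a.
Definition leT (a1 a2 : term) := notT (op Defs.Sub a1 a2).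
Definition posT (a : term) := notT (notT a).
Definition ltT (a1 a2 : term) := posT (op Defs.Sub a2 a1).
Definition eqT (a1 a2 : term) :=
  notT (op Add (op Defs.Sub a1 a2) (op Defs.Sub a2 a1)).
Definition andT (a1 a2 : term) := op Mul a1 a2.
Definition orT (a1 a2 : term) := notT (andT (notT a1) (notT a2)).
Definition modT (a1 a2 : term) := op Defs.Sub a1 (op Mul (op Div a1 a2) a2).
Definition minT (a1 a2 : term) := op Defs.Sub a1 (op Defs.Sub a1 a2).
Definition maxT (a1 a2 : term) := op Add a1 (op Defs.Sub a2 a1).
(** A conditional without branching: both branches are evaluated and one is multiplied by 0. Hence
    both must satisfy their bounds whatever the condition is. *)
Definition ifT (a a1 a2 : term) := op Add (op Mul a a1) (op Mul (notT a) a2).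
Definition powT (a n : term) := iterate n (cst 1) (fun _ acc => op Mul acc a).
Definition sumT (n : term) (f : term -> term) :=
  iterate n (cst 0) (fun i acc => op Add acc (f i)).
Definition exT (n : term) (f : term -> term) := posT (sumT n f).

Section Derived.

Variable M : machine.
Local Notation w := (input M).
Local Notation b := (width M).
Local Notation comp := (comp M).

Lemma lt1_exp2 : 1 < 2 ^ b. Proof. by rewrite -{1}(expn0 2) ltn_exp2l // width_gt0. Qed.

Lemma bool_lt (p : bool) : p < 2 ^ b.
Proof. exact: leq_ltn_trans (leq_b1 p) lt1_exp2. Qed.

Section Operators.

Variables (big : bool) (env : seq nat).
Implicit Types (a : term) (v : nat) (p : bool).

Lemma comp_add a1 a2 v1 v2 : comp big env a1 v1 -> comp big env a2 v2 ->
  v1 + v2 < 2 ^ b -> comp big env (op Add a1 a2) (v1 + v2).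
Proof. by move=> c1 c2 vP; apply: (comp_op (o := Add)). Qed.

Lemma comp_mul a1 a2 v1 v2 : comp big env a1 v1 -> comp big env a2 v2 ->
  v1 * v2 < 2 ^ b -> comp big env (op Mul a1 a2) (v1 * v2).
Proof. by move=> c1 c2 vP; apply: (comp_op (o := Mul)). Qed.

Lemma comp_sub a1 a2 v1 v2 : comp big env a1 v1 -> comp big env a2 v2 ->
  comp big env (op Defs.Sub a1 a2) (v1 - v2).
Proof.
move=> c1 c2; apply: (comp_op (o := Defs.Sub)) => //=.
exact: leq_ltn_trans (leq_subr _ _) (comp_lt c1).
Qed.

Lemma comp_div a1 a2 v1 v2 : comp big env a1 v1 -> comp big env a2 v2 ->
  comp big env (op Div a1 a2) (v1 %/ v2).
Proof.
move=> c1 c2; apply: (comp_op (o := Div)) => //=.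
exact: leq_ltn_trans (leq_div _ _) (comp_lt c1).
Qed.

Lemma comp_mod a1 a2 v1 v2 : comp big env a1 v1 -> comp big env a2 v2 ->
  comp big env (modT a1 a2) (v1 %% v2).
Proof.
move=> c1 c2; rewrite (_ : v1 %% v2 = v1 - v1 %/ v2 * v2).
  apply: comp_sub => //; apply: comp_mul => //; first exact: comp_div.
  exact: leq_ltn_trans (leq_divM _ _) (comp_lt c1).
by rewrite {2}(divn_eq v1 v2) addKn.
Qed.

Lemma comp_min a1 a2 v1 v2 : comp big env a1 v1 -> comp big env a2 v2 ->
  comp big env (minT a1 a2) (minn v1 v2).
Proof. by move=> c1 c2; rewrite minnE; do 2!apply: comp_sub => //. Qed.

Lemma comp_max a1 a2 v1 v2 : comp big env a1 v1 -> comp big env a2 v2 ->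
  comp big env (maxT a1 a2) (maxn v1 v2).
Proof.
move=> c1 c2; have vP : maxn v1 v2 < 2 ^ b by rewrite gtn_max !(comp_lt c1, comp_lt c2).
by move: vP; rewrite maxnE => vP; apply: comp_add => //; apply: comp_sub.
Qed.

Lemma comp_one : comp big env (cst 1) 1.
Proof. by apply: comp_cst; apply: lt1_exp2. Qed.

Lemma comp_zero : comp big env (cst 0) 0.
Proof. by apply: comp_cst; rewrite expn_gt0. Qed.

Lemma comp_notn a v : comp big env a v -> comp big env (notT a) (v == 0).
Proof. by move=> c; have := comp_sub comp_one c; case: (v) => //= n; rewrite subSS sub0n. Qed.

Lemma comp_not a p : comp big env a p -> comp big env (notT a) (~~ p).
Proof. by move=> c; have := comp_notn c; case: (p). Qed.

Lemma comp_le a1 a2 v1 v2 : comp big env a1 v1 -> comp big env a2 v2 ->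
  comp big env (leT a1 a2) (v1 <= v2).
Proof. by move=> c1 c2; apply: comp_notn (comp_sub c1 c2). Qed.

Lemma comp_pos a v : comp big env a v -> comp big env (posT a) (0 < v).
Proof. by move=> c; rewrite lt0n; apply: comp_not (comp_notn c). Qed.

Lemma comp_ltn a1 a2 v1 v2 : comp big env a1 v1 -> comp big env a2 v2 ->
  comp big env (ltT a1 a2) (v1 < v2).
Proof. by move=> c1 c2; rewrite -subn_gt0; apply: comp_pos (comp_sub c2 c1). Qed.

Lemma comp_eq a1 a2 v1 v2 : comp big env a1 v1 -> comp big env a2 v2 ->
  comp big env (eqT a1 a2) (v1 == v2).
Proof.
move=> c1 c2; rewrite eqn_leq -!subn_eq0 -addn_eq0; apply: comp_notn.
apply: comp_add; [exact: comp_sub|exact: comp_sub|].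
by have := comp_lt c1; have := comp_lt c2; lia.
Qed.

Lemma comp_and a1 a2 p1 p2 : comp big env a1 p1 -> comp big env a2 p2 ->
  comp big env (andT a1 a2) (p1 && p2).
Proof. by move=> c1 c2; rewrite -mulnb; apply: comp_mul => //; rewrite mulnb bool_lt. Qed.

Lemma comp_or a1 a2 p1 p2 : comp big env a1 p1 -> comp big env a2 p2 ->
  comp big env (orT a1 a2) (p1 || p2).
Proof.
by move=> c1 c2; rewrite -[_ || _]negbK negb_or; apply: comp_not; apply: comp_and; apply: comp_not.
Qed.

Lemma comp_if a a1 a2 p v1 v2 :
  comp big env a p -> comp big env a1 v1 -> comp big env a2 v2 ->
  comp big env (ifT a a1 a2) (if p then v1 else v2).
Proof.
move=> c c1 c2; have vP : (if p then v1 else v2) < 2 ^ b.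
  by case: (p); [apply: comp_lt c1 | apply: comp_lt c2].
rewrite (_ : (if p then v1 else v2) = p * v1 + (~~ p) * v2); last by case: (p) => /=; lia.
apply: comp_add.
- by apply: comp_mul => //; case: (p) => /=; rewrite ?mul1n ?(comp_lt c1) ?expn_gt0.
- apply: comp_mul => //; first exact: comp_not.
  by case: (p) => /=; rewrite ?mul1n ?(comp_lt c2) ?expn_gt0.
- by case: (p) vP => /=; lia.
Qed.

End Operators.

Lemma comp_sum big big' env n f vn (F : nat -> nat) :
  loop_bound M big big' vn -> comp big env n vn ->
  (forall i (env' : seq nat) x, i < vn -> prefix env env' -> comp false env' x i ->
     comp big' env' (f x) (F i)) ->
  \sum_(i < vn) F i < 2 ^ b ->
  comp big env (sumT n f) (\sum_(i < vn) F i).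
Proof.
move=> bound cn cf sP.
apply: (comp_iterate (F := fun k => \sum_(i < k) F i) bound cn) => [|i env' x y ivn pe cx cy].
  by rewrite big_ord0; apply: comp_zero.
rewrite big_ord_recr; apply: comp_add; [exact: comp_big cy | exact: cf |].
apply: leq_ltn_trans sP; rewrite -(big_mkord xpredT F) -(big_ord_recr i F) -(big_mkord xpredT F).
by rewrite (big_cat_nat (n := i.+1) (p := vn)) // leq_addr.
Qed.

Lemma comp_ex big big' env n f vn (p : nat -> bool) :
  loop_bound M big big' vn -> comp big env n vn ->
  (forall i (env' : seq nat) x, i < vn -> prefix env env' -> comp false env' x i ->
     comp big' env' (f x) (p i)) ->
  comp big env (exT n f) [exists i : 'I_vn, p i].
Proof.
move=> bound cn cf; rewrite (_ : [exists i : 'I_vn, p i] = (0 < \sum_(i < vn) p i)).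
  apply: comp_pos; apply: (comp_sum (F := fun i => p i) bound cn cf).
  apply: leq_ltn_trans (comp_lt cn); rewrite -[leqRHS](card_ord vn) -sum1_card.
  by apply: leq_sum => i _; apply: leq_b1.
rewrite lt0n sum_nat_eq0 negb_forall; apply: eq_existsb => i /=.
by rewrite eqb0 negbK.
Qed.

Lemma comp_pow big env a n v vn : vn <= small_limit M ->
  comp false env a v -> comp false env n vn -> v ^ vn < 2 ^ b ->
  comp big env (powT a n) (v ^ vn).
Proof.
move=> vnL ca cn vP; apply: comp_big.
apply: (comp_iterate (F := fun k => v ^ k) (big' := false) _ cn).
- by left.
- by rewrite expn0; apply: comp_one.
move=> i env' x y ivn pe cx cy; rewrite expnSr; apply: comp_mul => //.
  exact: comp_weaken pe _.
rewrite -expnSr; apply: leq_ltn_trans vP; case: (posnP v) => [->|v0].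
  by rewrite exp0n.
exact: leq_pexp2l.
Qed.

End Derived.

(** * Separating moduli *)

Lemma leq_expl a b e : a <= b -> a ^ e <= b ^ e.
Proof. by move=> ab; case: e => // e; rewrite leq_exp2r. Qed.

Lemma dvdn_logn m n : 0 < m -> 0 < n ->
  (forall p, prime p -> logn p m <= logn p n) -> m %| n.
Proof.
move=> m0 n0 le_log; apply/dvdn_partP => // p; rewrite mem_primes => /and3P[p_pr _ _].
by rewrite p_part pfactor_dvdn // le_log.
Qed.

(** By Legendre's formula the exponent is the sum over k of (2N div p^k) - 2 (N div p^k). Each term
    is at most 1, and it vanishes once p^k exceeds 2N. *)
Lemma logn_central_bin p N : prime p -> 0 < N -> logn p 'C(N + N, N) <= trunc_log p (N + N).
Proof.
move=> p_pr N0; have p1 := prime_gt1 p_pr; set e := trunc_log _ _.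
have := congr1 (logn p) (bin_fact (leq_addr N N)); rewrite addnK.
rewrite !lognM ?bin_gt0 ?muln_gt0 ?fact_gt0 ?leq_addr // !logn_fact //.
have -> : \sum_(1 <= k < N.+1) N %/ p ^ k = \sum_(1 <= k < (N + N).+1) N %/ p ^ k.
  rewrite [RHS](big_cat_nat (n := N.+1)) //= ?ltnS ?leq_addr //.
  rewrite [X in _ + X]big_nat_cond [X in _ + X]big1 ?addn0 // => k /andP[/andP[Nk _] _].
  by rewrite divn_small // (leq_trans Nk) // ltnW // ltn_expl.
rewrite -!big_split /= => H.
have : \sum_(1 <= k < (N + N).+1) (N + N) %/ p ^ k <=
    \sum_(1 <= k < (N + N).+1) (N %/ p ^ k + N %/ p ^ k + (k <= e)).
  apply: leq_sum => k _; case: (leqP k e) => ke.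
    have p0 : 0 < p ^ k by rewrite expn_gt0 prime_gt0.
    rewrite -ltnS ltn_divLR //.
    have := ltn_pmod N p0; have := divn_eq N (p ^ k); nia.
  rewrite divn_small //; apply: leq_trans (trunc_log_ltn _ p1) _.
  by rewrite leq_exp2l.
rewrite -H [leqRHS]big_split /= addnC leq_add2l => h; apply: leq_trans h _.
have eN : e <= N + N.
  by rewrite -(leq_exp2l _ _ p1) (leq_trans (trunc_logP _ _)) ?addn_gt0 ?N0 // ltnW // ltn_expl.
rewrite (big_cat_nat (n := e.+1)) //= [X in _ + X]big_nat_cond [X in _ + X]big1 ?addn0.
  apply: leq_trans (_ : \sum_(1 <= k < e.+1) 1 <= e); first by apply: leq_sum => i _; apply: leq_b1.
  by rewrite sum_nat_const_nat subn1 muln1.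
by move=> k /andP[/andP[ek _] _]; rewrite leqNgt ek.
Qed.

Lemma central_bin_ge N : 2 ^ N <= 'C(N + N, N).
Proof.
elim: N => // N IH; rewrite addSn addnS binS expnS mul2n -addnn.
apply: leq_add; first by rewrite binS (leq_trans IH) ?leq_addl.
exact: leq_trans IH (leq_bin2l _ (leqnSn _)).
Qed.

(* An integer divisible by 1, ..., 2N is a multiple of the central binomial
   coefficient, whose prime powers are at most 2N. *)
Lemma dvdn_all_ge N D : 0 < N -> 0 < D ->
  (forall d, 0 < d <= N + N -> d %| D) -> 2 ^ N <= D.
Proof.
move=> N0 D0 dvD; apply: leq_trans (central_bin_ge N) _; apply: dvdn_leq => //.
apply: dvdn_logn => // [|p p_pr]; first by rewrite bin_gt0 leq_addr.
apply: leq_trans (logn_central_bin p_pr N0) _; rewrite -pfactor_dvdn //.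
by apply: dvD; rewrite expn_gt0 prime_gt0 // trunc_logP ?prime_gt1 // addn_gt0 N0.
Qed.

Lemma separating_modulus (E : seq nat) (u s : nat) :
  all (fun c => c < 2 ^ u) E -> size E <= s ->
  exists2 p, 0 < p <= 2 * (u * (s * s)) + 2
    & {in E &, forall c d, c = d %[mod p] -> c = d}.
Proof.
(* [D] below is a product of at most [s * s] distances |c - d|, each less than [2 ^ u], whence
   [D < 2 ^ N]; the candidate moduli are 1, ..., 2N. *)
move=> E_lt sE; set N := (u * (s * s)).+1.
pose D := \prod_(c <- E) \prod_(d <- E | c != d) (maxn c d - minn c d).
have D0 : 0 < D by rewrite /D; apply: prodn_gt0 => c; apply: prodn_cond_gt0 => d cd; lia.
have D_lt : D < 2 ^ N.
  have inner c : c \in E -> \prod_(d <- E | c != d) (maxn c d - minn c d) <= 2 ^ (u * s).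
    move=> cE; apply: (@leq_trans (\prod_(d <- E) 2 ^ u)).
      rewrite big_mkcond big_seq [leqRHS]big_seq; apply: leq_prod => d dE.
      have := allP E_lt c cE; have := allP E_lt d dE.
      by case: ifP; lia.
    by rewrite big_const_seq count_predT iter_muln_1 -expnM leq_exp2l // leq_mul2l sE orbT.
  apply: (@leq_ltn_trans (\prod_(c <- E) 2 ^ (u * s))).
    by rewrite /D big_seq [leqRHS]big_seq; apply: leq_prod.
  rewrite big_const_seq count_predT iter_muln_1 -expnM ltn_exp2l // ltnS.
  by rewrite -mulnA leq_mul2l leq_mul2l sE !orbT.
have : [exists p : 'I_(N + N), ~~ (p.+1 %| D)].
  apply: contraLR D_lt; rewrite negb_exists => /forallP H; rewrite -leqNgt.
  apply: dvdn_all_ge => // d /andP[d0 dN].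
  by have := H (Ordinal (n := N + N) (m := d.-1) ltac:(lia)); rewrite negbK /= prednK.
case/existsP=> p ndvd; exists p.+1.
  by have := ltn_ord p; rewrite /N; lia.
move=> c d cE dE cd; apply: contraNeq ndvd => ncd.
have dvd_sub : p.+1 %| maxn c d - minn c d.
  case: (leqP c d) => cd_le; first by rewrite -eqn_mod_dvd // ?cd // cd.
  by rewrite -eqn_mod_dvd ?(ltnW cd_le) // cd.
rewrite /D (big_rem c) //= dvdn_mulr // big_mkcond (big_rem d) //= ncd.
by rewrite dvdn_mulr.
Qed.

(** Serves two encodings in a single number: the table of residues and colors, and the labelling of
    edge codes. *)
Lemma digits_sum b j (d : nat -> nat) : (forall i, i < j -> d i < b) ->
  \sum_(i < j) d i * b ^ i < b ^ j /\
  forall i, i < j -> (\sum_(h < j) d h * b ^ h) %/ b ^ i %% b = d i.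
Proof.
elim: j => [|j IH] dP; first by rewrite big_ord0.
have [mP mE] := IH (fun i ij => dP i (leqW ij)).
have dj := dP j (leqnn _); have b0 : 0 < b by apply: leq_trans dj.
rewrite big_ord_recr /= addnC; move: mP mE; set m := \sum_(i < j) _ => mP mE.
split; first by rewrite expnS; nia.
move=> i; rewrite ltnS leq_eqVlt => /orP[/eqP ->|ij].
  by rewrite divnMDl ?expn_gt0 ?b0 // divn_small // addn0 modn_small.
have -> : b ^ j = b ^ (j - i.+1) * b * b ^ i by rewrite -expnSr -expnD addSnnS subnK.
by rewrite -(mE i ij) !mulnA divnMDl ?expn_gt0 ?b0 // modnMDl.
Qed.

(** * Searching a family of hashed colorings *)

Ltac weaken pe :=
  lazymatch type of pe with
  | is_true (prefix ?e ?e') =>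
      repeat match goal with
      | H : comp _ _ e _ _ |- _ => apply (comp_weaken pe) in H
      end
  end.

(** * Terms that read the instance *)

Definition orderT := load (cst 0).
Definition targetT := minT (load (cst 1)) (op Add (op Mul orderT orderT) (cst 1)).
Definition adjT (u v : term) :=
  posT (load (op Add (cst 2) (op Add (op Mul u orderT) v))).
Definition codeT (u v : term) := op Add (op Mul (minT u v) orderT) (maxT u v).

(** Adjacency of plain numbers, read off the encoded input as the machine does it: the matrix begins
    at cell 2, after n and q. *)
Definition adjn (x : rainbow_instance) (i j : nat) : bool :=
  0 < nth 0 (encode_rainbow x) (2 + (i * order_of x + j)).

(* The edge {i, j} is represented by the number i * n + j, where i < j. *)
Definition code (n i j : nat) : nat := minn i j * n + maxn i j.

(* No instance with more than n ^ 2 demands is positive, so q may be cut off. *)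
Definition demand (x : rainbow_instance) : nat :=
  minn (target x) (order_of x * order_of x + 1).

Lemma code_lt n u v : u < n -> v < n -> code n u v < n * n.
Proof. by rewrite /code => un vn; nia. Qed.

Section Graph.

Variables (M : machine) (x : rainbow_instance).
Local Notation n := (order_of x).
Local Notation q := (demand x).
Local Notation L := (small_limit M).
Hypothesis inputE : input M = encode_rainbow x.
Hypothesis L_lt : L < 2 ^ width M.
Hypothesis n_small : n * n + n + 4 <= L.

Lemma small_lt v : v <= L -> v < 2 ^ width M.
Proof. by move=> vL; apply: leq_ltn_trans vL L_lt. Qed.

Lemma comp_small big env v : v <= L -> comp M big env (cst v) v.
Proof. by move=> vL; apply/comp_cst/small_lt. Qed.

Lemma comp_order big env : comp M big env orderT n.
Proof.
have -> : n = nth 0 (input M) 0 by rewrite inputE.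
by apply/comp_load/comp_zero.
Qed.

Lemma comp_target big env : comp M big env targetT q.
Proof.
apply: comp_min.
  have -> : target x = nth 0 (input M) 1 by rewrite inputE.
  exact/comp_load/comp_one.
apply: comp_add; [|exact: comp_one|by apply: small_lt; lia].
by apply: comp_mul; [exact: comp_order..|apply: small_lt; lia].
Qed.

Lemma comp_adj big env a1 a2 u v : u < n -> v < n ->
  comp M big env a1 u -> comp M big env a2 v -> comp M big env (adjT a1 a2) (adjn x u v).
Proof.
move=> un vn c1 c2; rewrite /adjn -inputE; apply/comp_pos/comp_load.
have h : u * n <= n * n by rewrite leq_mul2r ltnW ?orbT.
apply: comp_add; [by apply: comp_small; lia| |by apply: small_lt; lia].
apply: comp_add => //; last by apply: small_lt; lia.
by apply: comp_mul => //; [exact: comp_order|apply: small_lt; lia].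
Qed.

Lemma comp_code big env a1 a2 u v : u < n -> v < n ->
  comp M big env a1 u -> comp M big env a2 v -> comp M big env (codeT a1 a2) (code n u v).
Proof.
move=> un vn c1 c2; have := code_lt un vn; rewrite /code => cn.
apply: comp_add; [|exact: comp_max|by apply: small_lt; lia].
by apply: comp_mul; [exact: comp_min|exact: comp_order|apply: small_lt; lia].
Qed.

Lemma small_loop big vn : vn <= L -> loop_bound M big big vn.
Proof. by left. Qed.

End Graph.

(** Justifies [logT], which finds the logarithm by counting powers of two. *)
Lemma up_log_sum m : \sum_(i < m) (2 ^ i < m) = up_log 2 m.
Proof.
have E i : (2 ^ i < m) = (i < up_log 2 m).
  rewrite !ltnNge; congr (~~ _); apply/idP/idP => [h|h]; first exact: up_log_min.
  by apply: leq_trans (up_logP m (isT : 1 < 2)) _; rewrite leq_exp2l.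
have um : up_log 2 m <= m by apply: up_log_min => //; apply/ltnW/ltn_expl.
rewrite -(big_mkord xpredT (fun i => nat_of_bool (2 ^ i < m))).
rewrite (big_cat_nat (n := up_log 2 m)) //= [X in _ + X]big_nat_cond.
rewrite [X in _ + X]big1 ?addn0 => [|i /andP[/andP[ui _] _]]; last by rewrite E ltnNge ui.
rewrite big_nat_cond (eq_bigr (fun=> 1)) => [|i /andP[/andP[_ iu] _]]; last by rewrite E iu.
by rewrite -big_nat_cond sum_nat_const_nat subn0 muln1.
Qed.

Section Hashing.

Variable k : nat.

(* The digits in base [B] of [m] list pairs of a residue and a color, packed as
   residue * k + color; the last pair matching [c] modulo [p] is looked up. *)
Fixpoint lookup (B p m c j : nat) : nat :=
  if j is i.+1 then
    let d := m %/ B ^ i %% B in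
    if d %/ k == c %% p then d %% k else lookup B p m c i
  else 0.

Fixpoint reach (x : rainbow_instance) (col : nat -> nat) (v j u : nat)
    (vs cs : seq nat) : bool :=
  (u == v) ||
  if j is i.+1 then
    [exists y : 'I_(order_of x),
       [&& adjn x u y, val y \notin vs, col (code (order_of x) u y) \notin cs
         & reach x col v i y (val y :: vs) (col (code (order_of x) u y) :: cs)]]
  else false.

Definition edge_bound (x : rainbow_instance) : nat := 2 * k * demand x.
(** The bound of [separating_modulus] for numbers of [2 * up_log 2 n] bits, edge codes being less
    than n^2. Multiplied by [k] it exceeds every packed pair of a residue and a color, which gives
    [hash_base]. *)
Definition modulus_bound (x : rainbow_instance) : nat :=
  4 * (up_log 2 (order_of x) * (edge_bound x * edge_bound x)) + 2.
Definition hash_base (x : rainbow_instance) : nat := modulus_bound x * k.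

(** The search runs in both directions because a solution must connect both orders of a pair; thus
    no path ever has to be reversed in the proof. *)
Definition connected_pairs (x : rainbow_instance) (col : nat -> nat) : nat :=
  \sum_(u < order_of x) \sum_(v < order_of x)
    [&& u < v, ~~ adjn x u v, reach x col v k u [:: val u] [::]
      & reach x col u k v [:: val v] [::]].

Definition hash_search (x : rainbow_instance) : bool :=
  [exists p : 'I_(modulus_bound x), exists m : 'I_(hash_base x ^ edge_bound x),
     demand x <= connected_pairs x
       (fun c => lookup (hash_base x) p.+1 m c (edge_bound x))].

Definition edgesT := op Mul (cst (2 * k)) targetT.
Definition logT := sumT orderT (fun i => ltT (powT (cst 2) i) orderT).
Definition modulusT :=
  op Add (op Mul (cst 4) (op Mul logT (op Mul edgesT edgesT))) (cst 2).
Definition baseT := op Mul modulusT (cst k).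

Definition lookupT (p m c : term) :=
  iterate edgesT (cst 0) (fun j acc =>
    lett (modT (op Div m (powT baseT j)) baseT) (fun d =>
      ifT (eqT (op Div d (cst k)) (modT c p)) (modT d (cst k)) acc)).

Definition notinT (a : term) (s : seq term) : term :=
  foldr (fun y acc => andT (notT (eqT a y)) acc) (cst 1) s.

(** The recursion is unfolded when the term is built, not at run time: the program for [k] contains
    [k] nested loops over the vertices, a polynomial cost for fixed [k]. The visited vertices and
    used colors are lists of terms, in effect of registers. *)
Fixpoint reachT (col : term -> term) (v : term) (j : nat) (u : term)
    (vs cs : seq term) : term :=
  if j is i.+1 then
    orT (eqT u v) (exT orderT (fun y =>
      lett (codeT u y) (fun e => lett (col e) (fun c =>
        andT (adjT u y) (andT (notinT y vs) (andT (notinT c cs)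
          (reachT col v i y (y :: vs) (c :: cs))))))))
  else eqT u v.

Definition connected_pairsT (col : term -> term) :=
  sumT orderT (fun u => sumT orderT (fun v =>
    andT (ltT u v) (andT (notT (adjT u v))
      (andT (reachT col v k u [:: u] [::]) (reachT col u k v [:: v] [::]))))).

Definition hash_searchT :=
  exT modulusT (fun i => lett (op Add i (cst 1)) (fun p =>
    exT (powT baseT edgesT) (fun m =>
      leT targetT (connected_pairsT (fun c => lookupT p m c))))).

Variables (M : machine) (x : rainbow_instance).
Local Notation n := (order_of x).
Local Notation q := (demand x).
Local Notation L := (small_limit M).
Local Notation s := (edge_bound x).
Local Notation P := (modulus_bound x).
Local Notation B := (hash_base x).
Hypothesis k_gt0 : 0 < k.
Hypothesis inputE : input M = encode_rainbow x.
Hypothesis L_lt : L < 2 ^ width M.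
Hypothesis n_small : n * n + n + 4 <= L.
Hypothesis s_small : s + s * s + 2 * k <= L.
Hypothesis B_small : B + 1 <= L.
Hypothesis pow_n : 2 ^ n < 2 ^ width M.
Hypothesis pow_B : B ^ s < 2 ^ width M.
Hypothesis pow_T : B ^ s <= big_limit M.

Local Notation small_lt := (small_lt L_lt).

Lemma comp_edges big env : comp M big env edgesT s.
Proof.
apply: comp_mul; [by apply: (comp_small L_lt); lia|exact: (comp_target inputE L_lt n_small)|].
by apply: small_lt; move: s_small; rewrite /edge_bound; lia.
Qed.

Lemma comp_log big env : comp M big env logT (up_log 2 n).
Proof.
rewrite -up_log_sum; apply: (comp_sum (F := fun i => 2 ^ i < n)).
- by apply: small_loop; lia.
- exact: comp_order.
- move=> i env' y iN _ cy; apply: comp_ltn; last exact: comp_order.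
  apply: comp_pow => //; [by lia|by apply: (comp_small L_lt); lia|].
  by apply: leq_ltn_trans pow_n; rewrite leq_exp2l // ltnW.
- rewrite up_log_sum; apply: small_lt.
  by apply: leq_trans (up_log_min _ (ltnW (ltn_expl n (isT : 1 < 2)))) _ => //; lia.
Qed.

Lemma modulus_small : P <= L.
Proof. by apply: leq_trans B_small; rewrite addn1 leqW // leq_pmulr. Qed.

Lemma comp_modulus big env : comp M big env modulusT P.
Proof.
have PL := modulus_small; move: PL; rewrite /P -/s => PL.
apply: comp_add; [|by apply: (comp_small L_lt); lia|exact: small_lt].
apply: comp_mul; [by apply: (comp_small L_lt); lia| |by apply: small_lt; lia].
apply: comp_mul; [exact: comp_log| |by apply: small_lt; lia].
by apply: comp_mul; [exact: comp_edges..|apply: small_lt; lia].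
Qed.

Lemma comp_base big env : comp M big env baseT B.
Proof.
apply: comp_mul; [exact: comp_modulus|by apply: (comp_small L_lt); lia|].
by apply: small_lt; rewrite -/B; lia.
Qed.

Lemma base_gt0 : 0 < B.
Proof. by rewrite muln_gt0 k_gt0 /modulus_bound addn2. Qed.

Lemma comp_lookup env a1 a2 a3 p m c :
  comp M false env a1 p -> comp M false env a2 m -> comp M false env a3 c ->
  comp M false env (lookupT a1 a2 a3) (lookup B p m c s).
Proof.
move=> c1 c2 c3; apply: (comp_iterate (F := lookup B p m c)).
- by apply: small_loop; lia.
- exact: comp_edges.
- exact: comp_zero.
move=> j env1 y acc js pe1 cy cacc; weaken pe1.
apply: (comp_lett (v := m %/ B ^ j %% B)).
  apply: comp_mod; last exact: comp_base.
  apply: comp_div => //; apply: comp_pow => //; [by lia|exact: comp_base|].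
  by apply: leq_ltn_trans pow_B; rewrite leq_pexp2l ?base_gt0 // ltnW.
move=> env2 d pe2 cd; weaken pe2.
have ck : comp M false env2 (cst k) k by apply: (comp_small L_lt); lia.
by apply: comp_if => //; [apply: comp_eq; [exact: comp_div|exact: comp_mod]|exact: comp_mod].
Qed.

Lemma comp_notin env a v ts vs : comp M false env a v ->
  List.Forall2 (comp M false env) ts vs -> comp M false env (notinT a ts) (v \notin vs).
Proof.
move=> ca; elim=> [|t y ts' vs' ct _ IH] /=; first exact: comp_one.
by rewrite inE negb_or; apply: comp_and => //; apply/comp_not/comp_eq.
Qed.

Lemma Forall2_weaken env env' ts vs : prefix env env' ->
  List.Forall2 (comp M false env) ts vs -> List.Forall2 (comp M false env') ts vs.
Proof.
by move=> pe; elim=> [|t y ts' vs' ct _ IH]; constructor=> //; apply: comp_weaken ct.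
Qed.

Lemma comp_reach env colT col av v j au u ts vs ds cs :
  (forall env' a c, prefix env env' -> comp M false env' a c ->
     comp M false env' (colT a) (col c)) ->
  u < n -> comp M false env av v -> comp M false env au u ->
  List.Forall2 (comp M false env) ts vs -> List.Forall2 (comp M false env) ds cs ->
  comp M false env (reachT colT av j au ts ds) (reach x col v j u vs cs).
Proof.
elim: j env av au u ts vs ds cs => [|j IH] env av au u ts vs ds cs ccol un cv cu cvs ccs /=.
  by rewrite orbF; apply: comp_eq.
apply: comp_or; first exact: comp_eq.
apply: (comp_ex (p := fun y => [&& adjn x u y, y \notin vs, col (code n u y) \notin cs
  & reach x col v j y (y :: vs) (col (code n u y) :: cs)])).
- by apply: small_loop; lia.
- exact: comp_order.
move=> y env1 ay yn pe1 cy.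
apply: (comp_lett (v := code n u y)).
  by apply: comp_code => //; apply: comp_weaken pe1 _.
move=> env2 e pe2 ce; have pe12 := prefix_trans pe1 pe2.
apply: (comp_lett (v := col (code n u y))); first exact: ccol.
move=> env3 c pe3 cc; have pe13 := prefix_trans pe12 pe3; weaken pe2; weaken pe3.
have cvs' := Forall2_weaken pe13 cvs; have ccs' := Forall2_weaken pe13 ccs.
have cu' := comp_weaken pe13 cu; have cv' := comp_weaken pe13 cv.
apply: comp_and; first exact: comp_adj.
apply: comp_and; first exact: comp_notin.
apply: comp_and; first exact: comp_notin.
apply: IH => //; [|by constructor..].
by move=> env4 a d pe4; apply: ccol; apply: prefix_trans pe13 pe4.
Qed.

Lemma sum_bool_le m (p : 'I_m -> bool) : \sum_(i < m) p i <= m.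
Proof.
rewrite -[leqRHS](card_ord m) -sum1_card.
by apply: leq_sum => i _; apply: leq_b1.
Qed.

Lemma comp_connected_pairs env colT col :
  (forall env' a c, prefix env env' -> comp M false env' a c ->
     comp M false env' (colT a) (col c)) ->
  comp M false env (connected_pairsT colT) (connected_pairs x col).
Proof.
move=> ccol; apply: (comp_sum (F := fun u => \sum_(v < n)
    [&& u < v, ~~ adjn x u v, reach x col v k u [:: u] [::]
      & reach x col u k v [:: val v] [::]])).
- by apply: small_loop; lia.
- exact: comp_order.
- move=> u env1 au un pe1 cu; apply: (comp_sum (F := fun v =>
    [&& u < v, ~~ adjn x u v, reach x col v k u [:: u] [::]
      & reach x col u k v [:: v] [::]])).
  + by apply: small_loop; lia.
  + exact: comp_order.
  + move=> v env2 av vn pe2 cv; weaken pe2; have pe12 := prefix_trans pe1 pe2.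
    apply: comp_and; first exact: comp_ltn.
    apply: comp_and; first exact/comp_not/comp_adj.
    have ccol' env' a c : prefix env2 env' -> comp M false env' a c ->
        comp M false env' (colT a) (col c).
      by move=> pe; apply: ccol; apply: prefix_trans pe12 pe.
    have nil2 : List.Forall2 (comp M false env2) [::] [::] by exact: List.Forall2_nil.
    apply: comp_and; apply: comp_reach => //; apply: List.Forall2_cons => //.
  + by apply: small_lt; apply: leq_trans (sum_bool_le _) _; lia.
apply: small_lt; apply: (@leq_trans (\sum_(u < n) n)).
  by apply: leq_sum => u _; apply: sum_bool_le.
by rewrite sum_nat_const card_ord; lia.
Qed.

(** Only the loop over the tables [m] is big. The loop over the moduli around it is small, and so is
    everything inside it, as the ban on nested big loops demands. *)
Lemma comp_hash_search : comp M true [::] hash_searchT (hash_search x).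
Proof.
apply: (comp_ex (big' := true) (p := fun i => [exists m : 'I_(B ^ s),
  q <= connected_pairs x (fun c => lookup B i.+1 m c s)])).
- exact/small_loop/modulus_small.
- exact: comp_modulus.
move=> i env1 ai iP _ ci; apply: (comp_lett (v := i + 1)).
  apply: comp_big; apply: comp_add => //; first exact: comp_one.
  by apply: small_lt; rewrite addn1; apply: leq_trans iP modulus_small.
rewrite addn1 => env2 p pe2 cp.
apply: (comp_ex (big' := false) (p := fun m =>
  q <= connected_pairs x (fun c => lookup B i.+1 m c s))).
- by right.
- apply: comp_pow => //; [by lia|exact: comp_base|exact: comp_edges].
move=> m env3 am mB pe3 cm; weaken pe3.
apply: comp_le; first exact: comp_target.
apply: comp_connected_pairs => env4 a c pe4 ca; weaken pe4.
exact: comp_lookup.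
Qed.

End Hashing.

(** * Correctness of the search *)

Lemma set2_eq (T : finType) (a b c d : T) : [set a; b] = [set c; d] ->
  (a = c /\ b = d) \/ (a = d /\ b = c).
Proof.
move=> E; have Ha : a \in [set c; d] by rewrite -E set21.
have Hb : b \in [set c; d] by rewrite -E set22.
have Hc : c \in [set a; b] by rewrite E set21.
have Hd : d \in [set a; b] by rewrite E set22.
by case/set2P: Ha => ?; case/set2P: Hb => ?; case/set2P: Hc => ?; case/set2P: Hd => ?;
  subst; auto.
Qed.

Definition rainbow_pair k n (G : sgraph n) (col : {set 'I_n} -> 'I_k)
    (uv : 'I_n * 'I_n) : Prop :=
  [/\ uv.1 < uv.2, ~~ adj G uv.1 uv.2, rainbow_connected G col uv.1 uv.2
    & rainbow_connected G col uv.2 uv.1].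

(** An anti-edge is traded for its increasing ordered pair, which a double loop over numbers can
    enumerate. *)
Lemma has_rainbowP k (x : rainbow_instance) :
  has_rainbow_coloring k x <->
  exists (col : {set 'I_(order_of x)} -> 'I_k) (R : {set 'I_(order_of x) * 'I_(order_of x)}),
    target x <= #|R| /\ forall uv, uv \in R -> rainbow_pair (graph_of x) col uv.
Proof.
pose pairset (uv : 'I_(order_of x) * 'I_(order_of x)) := [set uv.1; uv.2].
split=> [[col [S [SA qS rcS]]]|[col [R [qR RP]]]].
  exists col, [set uv : 'I_(order_of x) * 'I_(order_of x) |
    (uv.1 < uv.2) && (pairset uv \in S)]; split.
    apply: leq_trans qS _; apply: leq_trans (leq_imset_card pairset _).
    apply/subset_leq_card/subsetP => e eS; have /imsetP[[a b]] := subsetP SA e eS.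
    rewrite inE /= => /andP[ab _] eE; subst e; apply/imsetP.
    case: (ltngtP a b) => [lab|lba|/val_inj/eqP]; last by rewrite (negPf ab).
      by exists (a, b); rewrite // inE lab.
    by exists (b, a); rewrite /pairset /= 1?setUC // inE /= lba /pairset /= setUC.
  move=> [a b]; rewrite inE /= => /andP[lab abS]; split=> //=.
  - have /imsetP[[c d]] := subsetP SA _ abS; rewrite inE /= => /andP[_ cd] E.
    by move: (set2_eq E) => /= -[[-> ->]|[-> ->]]; rewrite // adj_sym.
  - exact: rcS.
  - by apply: rcS; rewrite setUC.
exists col, (pairset @: R); split.
- apply/subsetP => e /imsetP[[a b] abR ->]; have [/= lab nab _ _] := RP _ abR.
  apply/imsetP; exists (a, b) => //; rewrite inE /= nab andbT.
  by apply: contraTneq lab => ->; rewrite ltnn.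
- rewrite card_in_imset // => -[a b] [c d] abR cdR /set2_eq /=.
  have [/= lab _ _ _] := RP _ abR; have [/= lcd _ _ _] := RP _ cdR.
  case=> [[-> ->] //|[ad bc]]; move: lab; rewrite ad bc => ldc.
  by have := ltn_trans ldc lcd; rewrite ltnn.
- move=> u v /imsetP[[a b] abR /set2_eq /= uvE]; have [/= _ _ r1 r2] := RP _ abR.
  by case: uvE => -[-> ->].
Qed.

Lemma demand_le x (R : {set 'I_(order_of x) * 'I_(order_of x)}) :
  (demand x <= #|R|) = (target x <= #|R|).
Proof.
rewrite /demand geq_min [X in _ || X]leqNgt; have := max_card (mem R).
by rewrite card_prod card_ord addn1 ltnS => ->; rewrite orbF.
Qed.

Lemma nth_allpairs (S T R : Type) (f : S -> T -> R) r0 s0 t0 (s : seq S) (t : seq T) i j :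
  i < size s -> j < size t ->
  nth r0 [seq f a b | a <- s, b <- t] (i * size t + j) = f (nth s0 s i) (nth t0 t j).
Proof.
elim: s i => // a s IH [|i] /= si tj; rewrite nth_cat size_map.
  by rewrite mul0n add0n tj (nth_map t0).
by rewrite mulSn -addnA ltnNge leq_addr /= addKn IH.
Qed.

Lemma adjnE x (u v : 'I_(order_of x)) : adjn x u v = adj (graph_of x) u v.
Proof.
have := @nth_allpairs _ _ _ (fun i j => nat_of_bool (adj (graph_of x) i j)) 0 u v
  (enum 'I_(order_of x)) (enum 'I_(order_of x)) u v.
by rewrite /adjn /= !size_enum_ord !nth_ord_enum => -> //; case: adj.
Qed.

Lemma codeC n i j : code n i j = code n j i.
Proof. by rewrite /code minnC maxnC. Qed.

Definition decode (n c : nat) : {set 'I_n} :=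
  [set i | (val i == c %/ n) || (val i == c %% n)].

Lemma decode_code n (u v : 'I_n) : decode n (code n u v) = [set u; v].
Proof.
have n0 : 0 < n by apply: leq_trans (ltn_ord u).
have mx : maxn u v < n by rewrite gtn_max !ltn_ord.
apply/setP=> i; rewrite !inE /code divnMDl // modnMDl divn_small // addn0 modn_small //.
by rewrite -!val_eqE /=; lia.
Qed.

(** Turns a coloring of codes, which is what the program constructs, into a coloring of sets; 0 is
    the default for sets not of the form {u, v}. *)
Definition set_code n (S : {set 'I_n}) : nat :=
  if [pick uv : 'I_n * 'I_n | S == [set uv.1; uv.2]] is Some uv
  then code n uv.1 uv.2 else 0.

Lemma set_codeE n (u v : 'I_n) : set_code [set u; v] = code n u v.
Proof.
rewrite /set_code; case: pickP => [[a b] /= /eqP /set2_eq|/(_ (u, v))]; last by rewrite eqxx.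
by case=> -[-> ->] //; rewrite codeC.
Qed.

(** * Bounded search for rainbow paths *)

Section Reach.

Variables (k : nat) (x : rainbow_instance).
Local Notation n := (order_of x).
Local Notation G := (graph_of x).

Definition path_codes (u : 'I_n) (p : seq 'I_n) : seq nat :=
  pairmap (fun a b : 'I_n => code n a b) u p.

(** Stated for arbitrary forbidden vertices [vs] and colors [cs], since both lists grow along the
    recursion; disjointness from them is what turns into [uniq] when the path is extended. *)
Lemma reachP (col : nat -> nat) j (u v : 'I_n) vs cs :
  reach x col v j u vs cs <->
  exists p : seq 'I_n, [/\ path (adj G) u p, last u p = v, size p <= j,
    uniq p && ~~ has (mem vs) (map val p)
    & let ds := map col (path_codes u p) in uniq ds && ~~ has (mem cs) ds].
Proof.
elim: j u vs cs => [|j IH] u vs cs /=.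
  rewrite orbF; split=> [/eqP uv|[[|y p] [] //= _ -> //]].
  by exists [::]; split=> //; apply: val_inj.
split=> [/orP[/eqP uv|/existsP[y /and4P[uy yvs ycs /IH]]]|].
- by exists [::]; split=> //; apply: val_inj.
- move=> [p [py lp sp /andP[up hp] /andP[ud hd]]]; exists (y :: p); split=> //=.
  + by rewrite -adjnE uy.
  + rewrite up andbT (negPf yvs) /=; move: hp; rewrite !has_map.
    rewrite -all_predC => /allP hp; apply/andP; split.
      by apply/negP=> /hp /=; rewrite inE eqxx.
    by rewrite -all_predC; apply/allP=> z /hp /=; rewrite inE negb_or => /andP[].
  + rewrite ud andbT (negPf ycs) /=; move: hd; rewrite -all_predC => /allP hd.
    apply/andP; split; first by apply/negP=> /hd /=; rewrite inE eqxx.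
    by rewrite -all_predC; apply/allP=> z /hd /=; rewrite inE negb_or => /andP[].
case=> -[|y p] [/= + + +].
  by move=> _ -> _ _ _; rewrite eqxx.
move=> /andP[uy py] lp sp /andP[/andP[yp up]] /norP[yvs hp] /andP[/andP[cp ud]] /norP[ycs hd].
apply/orP; right; apply/existsP; exists y; apply/and4P; split=> //; first by rewrite adjnE.
apply/IH; exists p; split=> //.
  rewrite up /= -all_predC; apply/allP=> _ /mapP[z zp ->] /=.
  rewrite inE negb_or; apply/andP; split; first by apply: contraNneq yp => /val_inj <-.
  by apply: contra hp => zvs; apply/hasP; exists (val z); rewrite ?map_f.
rewrite /= ud /= -all_predC; apply/allP=> z zp /=; rewrite inE negb_or; apply/andP; split.
  by apply: contraNneq cp => <-.
by apply: contra hd => zcs; apply/hasP; exists z.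
Qed.

Lemma edge_colors_codes (col : {set 'I_n} -> 'I_k) u p :
  map val (edge_colors col u p) = map (fun c => val (col (decode n c))) (path_codes u p).
Proof.
elim: p u => //= y p IH u; rewrite IH decode_code //.
Qed.

Lemma reach_rainbow (col : {set 'I_n} -> 'I_k) (coln : nat -> nat) (u v : 'I_n) :
  (forall a b : 'I_n, val (col [set a; b]) = coln (code n a b)) ->
  reach x coln v k u [:: val u] [::] -> rainbow_connected G col u v.
Proof.
move=> colE /reachP[p [pp lp _ /andP[up hp] /andP[ud _]]]; exists p; split=> //=.
  rewrite up andbT; apply: contra hp => uP; apply/hasP; exists (val u); first exact: map_f.
  by rewrite /= inE.
rewrite -(map_inj_uniq val_inj).
suff -> : map val (edge_colors col u p) = map coln (path_codes u p) by [].
by elim: p u {pp lp up hp ud} => //= y p IH u; rewrite colE IH.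
Qed.

(** The codes [E] are chosen before [coln]: whatever coloring agrees with [col] on [E] lets the
    search succeed, which is all that a hashed coloring can guarantee. *)
Lemma rainbow_reach (col : {set 'I_n} -> 'I_k) (u v : 'I_n) :
  rainbow_connected G col u v ->
  exists E : seq nat, [/\ size E <= k, all (fun c => c < n * n) E
    & forall coln, {in E, forall c, coln c = val (col (decode n c))} ->
      reach x coln v k u [:: val u] [::]].
Proof.
move=> [p [pp lp /= /andP[up uqp] uc]].
have sp : size (path_codes u p) = size p by rewrite size_pairmap.
have sk : size p <= k.
  have := max_card (mem (edge_colors col u p)).
  by rewrite (card_uniqP uc) size_pairmap card_ord.
exists (path_codes u p); split; first by rewrite sp.
  by elim: p u {pp lp up uqp uc sp sk} => //= y p IH u; rewrite IH andbT code_lt.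
move=> coln colE; apply/reachP; exists p; split=> //=.
  rewrite uqp /= -all_predC; apply/allP=> _ /mapP[z zp ->] /=.
  by rewrite inE; apply: contraNneq up => /val_inj <-.
have /eq_in_map -> := colE; rewrite has_pred0 andbT.
by rewrite -edge_colors_codes map_inj_uniq //; apply: val_inj.
Qed.

End Reach.

Section HashSearch.

Variables (k : nat) (x : rainbow_instance).
Local Notation n := (order_of x).
Local Notation G := (graph_of x).
Local Notation s := (edge_bound k x).
Local Notation B := (hash_base k x).
Hypothesis k_gt0 : 0 < k.

Definition reach_pairs (coln : nat -> nat) : {set 'I_n * 'I_n} :=
  [set uv : 'I_n * 'I_n | [&& uv.1 < uv.2, ~~ adjn x uv.1 uv.2,
    reach x coln uv.2 k uv.1 [:: val uv.1] [::]
    & reach x coln uv.1 k uv.2 [:: val uv.2] [::]]].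

Lemma connected_pairsE coln : connected_pairs k x coln = #|reach_pairs coln|.
Proof.
rewrite /connected_pairs pair_big /= -sum1_card [RHS]big_mkcond /=.
by apply: eq_bigr => uv _; rewrite inE; case: ifP.
Qed.

Lemma lookup_lt p m c j : lookup k B p m c j < k.
Proof. by elim: j => //= j IH; case: ifP => // _; apply: ltn_pmod. Qed.

Lemma lookup_eq p m c chi j :
  (forall i, i < j -> m %/ B ^ i %% B %/ k = c %% p -> m %/ B ^ i %% B %% k = chi) ->
  (exists2 i, i < j & m %/ B ^ i %% B %/ k = c %% p) ->
  lookup k B p m c j = chi.
Proof.
elim: j => [|j IH] H [i] //; rewrite ltnS leq_eqVlt => ij E /=.
case: eqP => [/H -> //|nE]; apply: IH => [i' ij'|]; first by apply: H; apply: leqW.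
by case/orP: ij => [/eqP ij|ij]; [case: nE; rewrite -ij | exists i].
Qed.

Lemma codes_lt_log (E : seq nat) : all (fun c => c < n * n) E ->
  all (fun c => c < 2 ^ (2 * up_log 2 n)) E.
Proof.
move=> /allP E_lt; apply/allP=> c /E_lt /leq_trans; apply.
by rewrite mul2n -addnn expnD leq_mul // up_logP.
Qed.

Lemma lookup_exists (E : seq nat) (chi : nat -> nat) :
  all (fun c => c < n * n) E -> size E <= s -> (forall c, chi c < k) ->
  exists2 p, p < modulus_bound k x & exists2 m, m < B ^ s
    & {in E, forall c, lookup k B p.+1 m c s = chi c}.
Proof.
move=> E_lt sE chi_lt.
have [p /andP[p0 pP] p_inj] := separating_modulus (codes_lt_log E_lt) sE.
exists p.-1; first by move: pP; rewrite /modulus_bound; lia.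
(* A table has exactly [s] entries, so [E] is padded with copies of its first element. Several
   entries may then match one residue, but since [p] separates [E] they all carry the same color, as
   [lookup_eq] requires. *)
rewrite prednK //; pose c_ i := nth (nth 0 E 0) E i.
have c_E i c : c \in E -> c_ i \in E.
  move=> cE; rewrite /c_; case: (ltnP i (size E)) => iE; first exact: mem_nth.
  by rewrite nth_default // mem_nth //; case: (E) cE.
have pB : p <= modulus_bound k x by move: pP; rewrite /modulus_bound; lia.
have [i _|mP mE] := @digits_sum B s (fun i => c_ i %% p * k + chi (c_ i)).
  have := ltn_pmod (c_ i) p0; have := chi_lt (c_ i); rewrite /hash_base; nia.
eexists; first exact: mP.
move=> c cE; apply: lookup_eq => [i ij|].
  rewrite mE // divnMDl // divn_small // addn0 modnMDl (modn_small (chi_lt _)).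
  by move=> cc; rewrite (p_inj _ _ (c_E i c cE) cE cc).
exists (index c E); first by apply: leq_trans sE; rewrite index_mem.
by rewrite mE ?(leq_trans _ sE) ?index_mem // divnMDl // divn_small // addn0 /c_ nth_index.
Qed.

Lemma rainbow_pairs_codes (col : {set 'I_n} -> 'I_k) (R : seq ('I_n * 'I_n)) :
  (forall uv, uv \in R -> rainbow_pair G col uv) ->
  exists E : seq nat, [/\ size E <= 2 * k * size R, all (fun c => c < n * n) E
    & forall coln, {in E, forall c, coln c = val (col (decode n c))} ->
      {subset R <= reach_pairs coln}].
Proof.
elim: R => [|[u v] R IH] RP; first by exists [::]; split.
have [|E [sE E_lt EP]] := IH; first by move=> uv uvR; apply: RP; rewrite inE uvR orbT.
have [/= uv nuv /rainbow_reach[E1 [s1 lt1 P1]] /rainbow_reach[E2 [s2 lt2 P2]]] :=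
  RP (u, v) (mem_head _ _).
exists (E1 ++ E2 ++ E); split; first by rewrite !size_cat /=; lia.
  by rewrite !all_cat lt1 lt2.
move=> coln colE [a b]; rewrite inE => /orP[/eqP[-> ->]|].
  rewrite inE /= uv adjnE nuv P1 ?P2 // => c cE; apply: colE; rewrite !mem_cat cE ?orbT //.
by apply: EP => c cE; apply: colE; rewrite !mem_cat cE !orbT.
Qed.

Lemma hash_searchP : reflect (has_rainbow_coloring k x) (hash_search k x).
Proof.
apply: (iffP idP) => [/existsP[p /existsP[m]]|].
  rewrite connected_pairsE; set coln := fun c => _ => qR.
  pose col (S : {set 'I_n}) : 'I_k := Ordinal (lookup_lt p.+1 m (set_code S) s).
  apply/has_rainbowP; exists col, (reach_pairs coln); split; first by rewrite -demand_le.
  move=> [u v]; rewrite inE /= => /and4P[uv nuv r1 r2].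
  have colE a b : val (col [set a; b]) = coln (code n a b) by rewrite /= set_codeE.
  by split; rewrite //= -?adjnE //; apply: reach_rainbow colE _.
case/has_rainbowP=> col [R [qR RP]].
have qR' : demand x <= #|R| by rewrite demand_le.
(* Exactly [demand x] pairs are retained, as the codes of a larger solution might not fit into a
   table of [edge_bound] entries. *)
have [R' R'R cR'] : exists2 R' : seq ('I_n * 'I_n),
    {subset R' <= R} & uniq R' /\ size R' = demand x.
  exists (take (demand x) (enum R)).
    by move=> uv /mem_take; rewrite mem_enum.
  by rewrite take_uniq ?enum_uniq // size_takel // -cardE.
have RP' uv : uv \in R' -> rainbow_pair G col uv by move/R'R/RP.
have [E [sE E_lt EP]] := rainbow_pairs_codes RP'.
have [uR' szR'] := cR'; rewrite szR' in sE.
have [p pP [m mP mE]] := lookup_exists E_lt sE (fun c => ltn_ord (col (decode n c))).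
apply/existsP; exists (Ordinal pP); apply/existsP; exists (Ordinal mP) => /=.
rewrite connected_pairsE -szR' -(card_uniqP uR'); apply/subset_leq_card/subsetP.
exact: EP.
Qed.

End HashSearch.

(** * Inclusion and exclusion over pairs at distance two *)

Section InclusionExclusion.

Variable x : rainbow_instance.
Local Notation n := (order_of x).
Local Notation m := (order_of x * order_of x).
Local Notation q := (demand x).

(* The pair (e / n, e mod n) is an anti-edge, listed once, at distance two. *)
Definition close_pair (e : nat) : bool :=
  [&& e %/ n < e %% n, ~~ adjn x (e %/ n) (e %% n)
    & [exists c : 'I_n, adjn x (e %/ n) c && adjn x c (e %% n)]].

(** Numbers the close pairs consecutively, so that their subsets are the numbers below
    [2 ^ close_count] and not just some of those below [2 ^ m]. *)
Definition pair_rank (e : nat) : nat := \sum_(i < e) close_pair i.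
Definition close_count : nat := pair_rank m.

(* The binary digits of [M] encode a set of close pairs. *)
Definition selected (M e : nat) : bool := close_pair e && odd (M %/ 2 ^ pair_rank e).
Definition selected_count (M : nat) : nat := \sum_(e < m) selected M e.

Definition merge (lab : nat -> nat) (a b z : nat) : nat :=
  if lab z == lab b then lab a else lab z.

(** The number t = (u n + v) n + c stands for a pair (u, v) with a candidate c for its middle
    vertex. When active, it forces equal colors on {u, c} and {c, v}. *)
Definition triple_active (M t : nat) : bool :=
  [&& selected M (t %/ n), adjn x (t %/ n %/ n) (t %% n)
    & adjn x (t %% n) (t %/ n %% n)].

(* Representatives of the classes of edge codes that must get equal colors when
   the selected pairs are to remain unsatisfied, after [t] steps. *)
Fixpoint labels (M t : nat) : nat -> nat :=
  if t is i.+1 then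
    if triple_active M i
    then merge (labels M i) (code n (i %/ n %/ n) (i %% n)) (code n (i %/ n %% n) (i %% n))
    else labels M i
  else id.

(** Labels are idempotent, so each class contains exactly one fixed point. Colorings are defined on
    all [m] codes; the code of a non-edge is never merged and forms its own class. *)
Definition class_count (M : nat) : nat := \sum_(z < m) (labels M (m * n) z == z).

Definition ybase : nat := 2 ^ (m + 1).
(** For a coloring f, y^(sat f) is the product over the close pairs of y + (1 - y) [unsatisfied].
    Expanding it and summing over all f yields, for each set [M], this number with sign (-1)^|M|. *)
Definition summand (M : nat) : nat :=
  ybase ^ (close_count - selected_count M) * (ybase - 1) ^ selected_count M
  * 2 ^ class_count M.

(** Both sides of the disjunction [sieve] are evaluated. If there are at least 2q close pairs, the
    cut keeps the sums within 4^q terms, and their value is overridden by the first disjunct. *)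
Definition rank_limit : nat := minn close_count (2 * q).
Definition even_sum : nat :=
  \sum_(M < 2 ^ rank_limit) if odd (selected_count M) then 0 else summand M.
Definition odd_sum : nat :=
  \sum_(M < 2 ^ rank_limit) if odd (selected_count M) then summand M else 0.

Definition sieve : bool :=
  (2 * q <= close_count) || (odd_sum + ybase ^ q <= even_sum).

(** A labelling must fit one accumulator of [iterate], hence its values become the digits in base
    [m]. *)
Definition label_code (lab : nat -> nat) : nat := \sum_(z < m) lab z * m ^ z.

Definition sizeT := op Mul orderT orderT.
Definition close_pairT (e : term) :=
  lett (op Div e orderT) (fun u => lett (modT e orderT) (fun v =>
    andT (ltT u v) (andT (notT (adjT u v))
      (exT orderT (fun c => andT (adjT u c) (adjT c v)))))).
Definition pair_rankT (e : term) := sumT e close_pairT.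
Definition oddT (a : term) := modT a (cst 2).
Definition selectedT (M e : term) :=
  andT (close_pairT e) (oddT (op Div M (powT (cst 2) (pair_rankT e)))).
Definition selected_countT (M : term) := sumT sizeT (selectedT M).
Definition labelT (l z : term) := modT (op Div l (powT sizeT z)) sizeT.
Definition mergeT (l a b : term) :=
  lett (labelT l a) (fun la => lett (labelT l b) (fun lb =>
    sumT sizeT (fun z => lett (labelT l z) (fun lz =>
      op Mul (ifT (eqT lz lb) la lz) (powT sizeT z))))).
Definition labelsT (M : term) :=
  iterate (op Mul sizeT orderT) (sumT sizeT (fun z => op Mul z (powT sizeT z)))
    (fun t l => lett (op Div t orderT) (fun e => lett (modT t orderT) (fun c =>
      lett (op Div e orderT) (fun u => lett (modT e orderT) (fun v =>
        ifT (andT (selectedT M e) (andT (adjT u c) (adjT c v)))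
          (mergeT l (codeT u c) (codeT v c)) l))))).
Definition class_countT (M : term) :=
  lett (labelsT M) (fun l => sumT sizeT (fun z => eqT (labelT l z) z)).
Definition ybaseT := powT (cst 2) (op Add sizeT (cst 1)).
Definition close_countT := pair_rankT sizeT.
Definition summandT (M t : term) :=
  op Mul (op Mul (powT ybaseT (op Defs.Sub close_countT t))
                 (powT (op Defs.Sub ybaseT (cst 1)) t))
         (powT (cst 2) (class_countT M)).
Definition demand2T := op Mul (cst 2) targetT.
Definition sum_limitT := powT (cst 2) (minT close_countT demand2T).
Definition even_sumT :=
  sumT sum_limitT (fun M => lett (selected_countT M) (fun t =>
    ifT (oddT t) (cst 0) (summandT M t))).
Definition odd_sumT :=
  sumT sum_limitT (fun M => lett (selected_countT M) (fun t =>
    ifT (oddT t) (summandT M t) (cst 0))).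
Definition sieveT :=
  orT (leT demand2T close_countT)
    (leT (op Add odd_sumT (powT ybaseT targetT)) even_sumT).

Lemma pair_rank_le e : pair_rank e <= e.
Proof. exact: sum_bool_le. Qed.

Lemma selected_rank M e : \sum_(i < e) selected M i <= pair_rank e.
Proof. by apply: leq_sum => i _; rewrite /selected; case: close_pair; rewrite ?leq_b1. Qed.

Lemma selected_count_le M : selected_count M <= close_count.
Proof. exact: selected_rank. Qed.

Lemma close_count_le : close_count <= m.
Proof. exact: pair_rank_le. Qed.

Lemma label_lt M t z : t <= m * n -> z < m -> labels M t z < m.
Proof.
elim: t z => //= t IH z tm zm; have n0 : 0 < n by case: (n) tm.
have un : t %/ n %/ n < n by rewrite !ltn_divLR.
have ltm := IH _ (ltnW tm).
case: ifP => _; last exact: ltm.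
rewrite /merge; case: ifP => _; last exact: ltm.
by apply: ltm; rewrite code_lt ?ltn_pmod.
Qed.

Lemma label_codeP lab : (forall z, z < m -> lab z < m) ->
  label_code lab < m ^ m /\
  forall z, z < m -> label_code lab %/ m ^ z %% m = lab z.
Proof. exact: digits_sum. Qed.

Lemma summand_le M : summand M <= 2 ^ (m * m + 2 * m).
Proof.
have tc := selected_count_le M; have cm := close_count_le.
have kc : class_count M <= m by apply: sum_bool_le.
apply: (@leq_trans (ybase ^ close_count * 2 ^ m)).
  rewrite leq_mul ?leq_exp2l // -{2}(subnK tc) expnD leq_mul2l leq_expl ?orbT //.
  exact: leq_subr.
rewrite /ybase -expnM -expnD leq_exp2l //; nia.
Qed.

(** * Compilation of the sieve *)

Variable M : machine.
Local Notation L := (small_limit M).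
Hypothesis inputE : input M = encode_rainbow x.
Hypothesis L_lt : L < 2 ^ width M.
Hypothesis n_small : n * n + n + 4 <= L.
Hypothesis mn_small : m * n + 2 * m + 2 <= L.
Hypothesis m_width : (m + 3) * (m + 3) <= width M.
Hypothesis limit_T : 2 ^ rank_limit <= big_limit M.

Local Notation small_lt := (small_lt L_lt).

(** The width [(m + 3) * (m + 3)] is dictated by the largest bound used, 2^(m^2 + 3m + 2) for
    [odd_sum + ybase ^ q]. *)
Lemma pow_lt v e : v <= 2 ^ e -> e < (m + 3) * (m + 3) -> v < 2 ^ width M.
Proof.
move=> ve em; apply: leq_ltn_trans ve _; rewrite ltn_exp2l //.
exact: leq_trans em m_width.
Qed.

Lemma comp_size big env : comp M big env sizeT m.
Proof. by apply: comp_mul; [exact: comp_order..|apply: small_lt; lia]. Qed.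

Lemma comp_two big env : comp M big env (cst 2) 2.
Proof. by apply: (comp_small L_lt); lia. Qed.

Lemma comp_close_pair env a e : e < m -> comp M false env a e ->
  comp M false env (close_pairT a) (close_pair e).
Proof.
move=> em ce; have n0 : 0 < n by case: (n) em.
have un : e %/ n < n by rewrite ltn_divLR.
have vn : e %% n < n by rewrite ltn_pmod.
apply: (comp_lett (v := e %/ n)); first by apply: comp_div => //; exact: comp_order.
move=> env1 u pe1 cu; weaken pe1.
apply: (comp_lett (v := e %% n)); first by apply: comp_mod => //; exact: comp_order.
move=> env2 v pe2 cv; weaken pe2.
apply: comp_and; first exact: comp_ltn.
apply: comp_and; first by apply: comp_not; apply: comp_adj.
apply: (comp_ex (p := fun c => adjn x (e %/ n) c && adjn x c (e %% n))).
- by apply: small_loop; lia.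
- exact: comp_order.
- by move=> c env3 ac cn pe3 cc; weaken pe3; apply: comp_and; apply: comp_adj.
Qed.

Lemma comp_pair_rank env a e : e <= m -> comp M false env a e ->
  comp M false env (pair_rankT a) (pair_rank e).
Proof.
move=> em ce; apply: (comp_sum (F := close_pair)) => //.
- by apply: small_loop; lia.
- move=> i env1 ai ie pe1 ci; apply: comp_close_pair => //.
  exact: leq_trans ie em.
- by apply: small_lt; have := pair_rank_le e; rewrite /pair_rank; lia.
Qed.

Lemma comp_odd big env a v : comp M big env a v -> comp M big env (oddT a) (odd v).
Proof. by move=> c; rewrite -modn2; apply: comp_mod => //; exact: comp_two. Qed.

Lemma comp_selected env aM Mv a e : e < m -> comp M false env aM Mv ->
  comp M false env a e -> comp M false env (selectedT aM a) (selected Mv e).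
Proof.
move=> em cM ce; have re := pair_rank_le e.
apply: comp_and; first exact: comp_close_pair.
apply/comp_odd/comp_div => //; apply: comp_pow.
- by lia.
- exact: comp_two.
- by apply: comp_pair_rank => //; apply: ltnW.
- by apply: (pow_lt (leqnn _)); nia.
Qed.

Lemma comp_selected_count env aM Mv : comp M false env aM Mv ->
  comp M false env (selected_countT aM) (selected_count Mv).
Proof.
move=> cM; have := selected_count_le Mv; have := close_count_le => lc ls.
apply: (comp_sum (F := selected Mv)).
- by apply: small_loop; lia.
- exact: comp_size.
- by move=> e env1 a em pe1 ce; weaken pe1; apply: comp_selected.
- by apply: small_lt; move: ls; rewrite /selected_count; lia.
Qed.

Lemma pow_m_lt e : e <= m -> m ^ e < 2 ^ width M.
Proof.
move=> em; apply: (@pow_lt _ (m * m)); last by nia.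
rewrite expnM; apply: (@leq_trans ((2 ^ m) ^ e)).
  exact/leq_expl/ltnW/ltn_expl.
by rewrite leq_pexp2l // expn_gt0.
Qed.

Lemma comp_label env al lab a z : (forall z, z < m -> lab z < m) -> z < m ->
  comp M false env al (label_code lab) -> comp M false env a z ->
  comp M false env (labelT al a) (lab z).
Proof.
move=> ltm zm cl cz; have [_ <- //] := label_codeP ltm.
apply: comp_mod; last exact: comp_size.
apply: comp_div => //; apply: comp_pow => //; [by lia|exact: comp_size|].
exact/pow_m_lt/ltnW.
Qed.

Lemma comp_merge env al lab a u b v :
  (forall z, z < m -> lab z < m) -> u < m -> v < m ->
  comp M false env al (label_code lab) -> comp M false env a u -> comp M false env b v ->
  comp M false env (mergeT al a b) (label_code (merge lab u v)).
Proof.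
move=> ltm um vm cl cu cv.
have mtm z : z < m -> merge lab u v z < m
  by rewrite /merge; case: ifP => _; [move=> _|]; apply: ltm.
apply: (comp_lett (v := lab u)); first exact: comp_label.
move=> env1 la pe1 cla; weaken pe1.
apply: (comp_lett (v := lab v)); first exact: comp_label.
move=> env2 lb pe2 clb; weaken pe2.
apply: (comp_sum (F := fun z => merge lab u v z * m ^ z)).
- by apply: small_loop; lia.
- exact: comp_size.
- move=> z env3 az zm pe3 cz; weaken pe3.
  apply: (comp_lett (v := lab z)); first exact: comp_label.
  move=> env4 lz pe4 clz; weaken pe4; apply: comp_mul.
  + by apply: comp_if => //; apply: comp_eq.
  + by apply: comp_pow => //; [lia|exact: comp_size|apply/pow_m_lt/ltnW].
  + apply: leq_ltn_trans (pow_m_lt (leqnn m)); rewrite -/(merge lab u v z).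
    apply: (@leq_trans (m * m ^ z)); first by rewrite leq_mul2r ltnW ?mtm ?orbT.
    by rewrite -expnS leq_pexp2l //; case: (m) zm.
- have [lc _] := label_codeP mtm.
  exact: leq_trans lc (ltnW (pow_m_lt (leqnn m))).
Qed.

Lemma comp_labels env aM Mv : comp M false env aM Mv ->
  comp M false env (labelsT aM) (label_code (labels Mv (m * n))).
Proof.
move=> cM; apply: (comp_iterate (F := fun t => label_code (labels Mv t))).
- by apply: small_loop; lia.
- by apply: comp_mul; [exact: comp_size|exact: comp_order|apply: small_lt; lia].
- apply: (comp_sum (F := fun z => z * m ^ z)).
  + by apply: small_loop; lia.
  + exact: comp_size.
  + move=> z env1 a zm pe1 cz; apply: comp_mul => //.
      by apply: comp_pow => //; [lia|exact: comp_size|apply/pow_m_lt/ltnW].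
    apply: leq_ltn_trans (pow_m_lt (leqnn m)).
    apply: (@leq_trans (m * m ^ z)); first by rewrite leq_mul2r ltnW ?orbT.
    by rewrite -expnS leq_pexp2l //; case: (m) zm.
  + have [//|lc _] := @label_codeP id.
    exact: leq_trans lc (ltnW (pow_m_lt (leqnn m))).
move=> t env1 at_ al tm pe1 ct cl; weaken pe1.
have n0 : 0 < n by case: (n) tm.
have em : t %/ n < m by rewrite ltn_divLR.
have un : t %/ n %/ n < n by rewrite ltn_divLR.
have vn : t %/ n %% n < n by rewrite ltn_pmod.
have cn : t %% n < n by rewrite ltn_pmod.
have ltm := label_lt Mv (ltnW tm).
apply: (comp_lett (v := t %/ n)); first by apply: comp_div => //; exact: comp_order.
move=> env2 e pe2 ce; weaken pe2.
apply: (comp_lett (v := t %% n)); first by apply: comp_mod => //; exact: comp_order.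
move=> env3 c pe3 cc; weaken pe3.
apply: (comp_lett (v := t %/ n %/ n)); first by apply: comp_div => //; exact: comp_order.
move=> env4 u pe4 cu; weaken pe4.
apply: (comp_lett (v := t %/ n %% n)); first by apply: comp_mod => //; exact: comp_order.
move=> env5 v pe5 cv; weaken pe5.
have -> : label_code (labels Mv t.+1) = if triple_active Mv t
    then label_code (merge (labels Mv t) (code n (t %/ n %/ n) (t %% n))
                       (code n (t %/ n %% n) (t %% n)))
    else label_code (labels Mv t) by rewrite /=; case: ifP.
apply: comp_if => //.
  apply: comp_and; first exact: comp_selected.
  by apply: comp_and; apply: comp_adj.
by apply: comp_merge => //; rewrite ?code_lt //; apply: comp_code.
Qed.

Lemma comp_class_count env aM Mv : comp M false env aM Mv ->
  comp M false env (class_countT aM) (class_count Mv).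
Proof.
move=> cM; apply: (comp_lett (v := label_code (labels Mv (m * n)))).
  exact: comp_labels.
move=> env1 l pe1 cl; apply: (comp_sum (F := fun z => labels Mv (m * n) z == z)).
- by apply: small_loop; lia.
- exact: comp_size.
- move=> z env2 a zm pe2 cz; weaken pe2; apply: comp_eq => //.
  by apply: comp_label => // y; apply: label_lt.
- by apply: small_lt; apply: leq_trans (sum_bool_le _) _; lia.
Qed.

Lemma comp_ybase big env : comp M big env ybaseT ybase.
Proof.
apply: comp_pow.
- by lia.
- exact: comp_two.
- by apply: comp_add; [exact: comp_size|exact: comp_one|apply: small_lt; lia].
- by apply: (pow_lt (leqnn _)); nia.
Qed.

Lemma comp_close_count env : comp M false env close_countT close_count.
Proof. by apply: comp_pair_rank => //; exact: comp_size. Qed.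

Lemma ybase_pow_lt e : e <= m + 1 -> ybase ^ e < 2 ^ width M.
Proof. by move=> em; apply: (@pow_lt _ ((m + 1) * e)); rewrite ?expnM //; nia. Qed.

Lemma comp_summand env aM Mv at_ : comp M false env aM Mv ->
  comp M false env at_ (selected_count Mv) ->
  comp M false env (summandT aM at_) (summand Mv).
Proof.
move=> cM ct; have ls := selected_count_le Mv; have lc := close_count_le.
have sW : summand Mv < 2 ^ width M by apply: (pow_lt (summand_le Mv)); nia.
have kc : class_count Mv <= m by apply: sum_bool_le.
have y1 : ybase - 1 <= ybase by apply: leq_subr.
have y_gt1 : 0 < ybase - 1 by rewrite subn_gt0 -{1}(expn0 2) ltn_exp2l // addn1.
apply: comp_mul => //; last first.
  apply: comp_pow; [by lia|exact: comp_two|exact: comp_class_count|].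
  by apply: (pow_lt (leqnn _)); nia.
apply: comp_mul.
- apply: comp_pow; [by lia|exact: comp_ybase| |by apply: ybase_pow_lt; lia].
  by apply: comp_sub => //; exact: comp_close_count.
- apply: comp_pow => //; [by lia| |].
    by apply: comp_sub; [exact: comp_ybase|exact: comp_one].
  by apply: leq_ltn_trans (leq_expl _ y1) _; apply: ybase_pow_lt; lia.
- by apply: leq_ltn_trans sW; rewrite /summand leq_pmulr // expn_gt0.
Qed.

Lemma comp_demand2 big env : comp M big env demand2T (2 * q).
Proof.
apply: comp_mul; [exact: comp_two|exact: comp_target|apply: small_lt].
by apply: leq_trans mn_small; rewrite /q; lia.
Qed.

Lemma comp_sum_limit env : comp M false env sum_limitT (2 ^ rank_limit).
Proof.
have lc := close_count_le; have rc : rank_limit <= close_count by apply: geq_minl.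
apply: comp_pow; [by lia|exact: comp_two| |by apply: (pow_lt (leqnn _)); nia].
by apply: comp_min; [exact: comp_close_count|exact: comp_demand2].
Qed.

Lemma sum_summand_le (F : nat -> nat) : (forall Mv, F Mv <= summand Mv) ->
  \sum_(Mv < 2 ^ rank_limit) F Mv <= 2 ^ (m * m + 3 * m).
Proof.
move=> FP; have lc := close_count_le; have rc : rank_limit <= close_count by apply: geq_minl.
apply: (@leq_trans (\sum_(Mv < 2 ^ rank_limit) 2 ^ (m * m + 2 * m))).
  by apply: leq_sum => Mv _; apply: leq_trans (FP _) (summand_le _).
by rewrite sum_nat_const card_ord -expnD leq_exp2l //; lia.
Qed.

Lemma even_sum_le : even_sum <= 2 ^ (m * m + 3 * m).
Proof.
by apply: (sum_summand_le (F := fun Mv => if odd (selected_count Mv) then 0 else summand Mv))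
  => Mv; case: ifP.
Qed.

Lemma odd_sum_le : odd_sum <= 2 ^ (m * m + 3 * m).
Proof.
by apply: (sum_summand_le (F := fun Mv => if odd (selected_count Mv) then summand Mv else 0))
  => Mv; case: ifP.
Qed.

Lemma comp_sieve : comp M true [::] sieveT sieve.
Proof.
(* The cut in [demand] keeps [ybase ^ q] within the registers however large the target is. *)
have qm : q <= m + 1 by apply: geq_minr.
have zero env : comp M false env (cst 0) 0 by apply: comp_zero.
apply: comp_or.
  by apply: comp_le; [exact: comp_demand2|apply/comp_big/comp_close_count].
apply: comp_le.
  apply: comp_add.
  - apply: (comp_sum (big' := false)
      (F := fun Mv => if odd (selected_count Mv) then summand Mv else 0)).
    + by right.
    + exact/comp_big/comp_sum_limit.
    + move=> Mv env1 aM _ _ cM; apply: (comp_lett (v := selected_count Mv)).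
        exact: comp_selected_count.
      move=> env2 t pe2 ct; weaken pe2.
      by apply: comp_if => //; [exact: comp_odd|exact: comp_summand].
    + by apply: (pow_lt odd_sum_le); nia.
  - apply: comp_pow; [by lia|exact: comp_ybase|exact: comp_target|exact: ybase_pow_lt].
  - apply: (@pow_lt _ (m * m + 3 * m + 2)); last by nia.
    have h1 : ybase ^ q <= 2 ^ (m * m + 3 * m + 1).
      by rewrite /ybase -expnM leq_exp2l //; nia.
    have := odd_sum_le; rewrite !addn1 !addn2 !expnS in h1 *; lia.
apply: (comp_sum (big' := false)
  (F := fun Mv => if odd (selected_count Mv) then 0 else summand Mv)).
- by right.
- exact/comp_big/comp_sum_limit.
- move=> Mv env1 aM _ _ cM; apply: (comp_lett (v := selected_count Mv)).
    exact: comp_selected_count.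
  move=> env2 t pe2 ct; weaken pe2.
  by apply: comp_if => //; [exact: comp_odd|exact: comp_summand].
- by apply: (pow_lt even_sum_le); nia.
Qed.

End InclusionExclusion.

(** * Correctness of inclusion and exclusion *)

(** An invariant set is determined by its trace on the fixed points of [l], and any set of fixed
    points is the trace of its preimage under [l]. *)
Lemma card_invariant_sets (T : finType) (l : T -> T) : idempotent_fun l ->
  #|[set f : {set T} | [forall z, (z \in f) == (l z \in f)]]| = 2 ^ #|[set z | l z == z]|.
Proof.
move=> ll; set D := [set z | _]; rewrite -card_powerset.
have lD z : l z \in D by rewrite inE; apply/eqP; exact: ll.
rewrite -(card_in_imset (f := fun f => f :&: D)).
  congr #|pred_of_set _|; apply/setP=> A; rewrite powersetE; apply/imsetP/idP => [[f _ ->]|AD].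
    exact: subsetIr.
  exists (l @^-1: A).
    by rewrite inE; apply/forallP=> z; rewrite !inE; apply/eqP; rewrite [l (l z)]ll.
  apply/setP=> z; rewrite !inE; case: eqP => [->|lz]; first by rewrite andbT.
  by rewrite andbF; apply/negbTE/negP => /(subsetP AD); rewrite inE => /eqP.
move=> f g; rewrite !inE => /forallP fl /forallP gl fg; apply/setP=> z.
rewrite (eqP (fl z)) (eqP (gl z)); have := congr1 (fun A : {set T} => l z \in A) fg.
by rewrite /= !inE; have := lD z; rewrite inE => ->; rewrite !andbT.
Qed.

(** Toggling the membership of [a] is an involution that sends non-separating sets to separating
    ones, so at least half of all sets separate. *)
Lemma card_separating_sets (T : finType) (a b : T) : a != b ->
  #|{set T}| <= 2 * #|[set f : {set T} | (a \in f) != (b \in f)]|.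
Proof.
move=> ab; set S := [set f | _]; rewrite -(cardsC S) mul2n -addnn leq_add2l.
pose flip (f : {set T}) := if a \in f then f :\ a else a |: f.
have flipK : involutive flip.
  move=> f; rewrite /flip; case af: (a \in f); first by rewrite setD11 setD1K.
  by rewrite setU11 setU1K // af.
rewrite -(card_imset _ (inv_inj flipK)); apply/subset_leq_card/subsetP => _ /imsetP[f + ->].
rewrite !inE negbK /flip => /eqP fab; case af: (a \in f).
  by rewrite setD11 !inE (eq_sym b a) ab /= -fab af.
by rewrite setU11 !inE (eq_sym b a) (negPf ab) /= -fab af.
Qed.

Lemma pair_sum n (F : nat -> nat) :
  \sum_(e < n * n) F e = \sum_(u < n) \sum_(v < n) F (u * n + v).
Proof.
suff H k : \sum_(e < k * n) F e = \sum_(u < k) \sum_(v < n) F (u * n + v) by apply: H.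
elim: k => [|k IH]; first by rewrite mul0n !big_ord0.
rewrite big_ord_recr -IH /= -[in RHS](big_mkord xpredT F) -(big_mkord xpredT F).
rewrite mulSn addnC (big_cat_nat (n := k * n)) ?leq_addr //=; congr (_ + _).
rewrite -{1}(add0n (k * n)) big_addn addnC addnK big_mkord.
by apply: eq_bigr => v _; rewrite addnC.
Qed.

Section Sieve.

Variable x : rainbow_instance.
Local Notation n := (order_of x).
Local Notation m := (order_of x * order_of x).
Local Notation q := (demand x).
Local Notation coloring := {set 'I_m}.

Definition color_of (f : coloring) (z : nat) : bool :=
  [exists j : 'I_m, (val j == z) && (j \in f)].

Lemma color_ofE (f : coloring) (j : 'I_m) : color_of f j = (j \in f).
Proof.
apply/existsP/idP => [[i /andP[/eqP/val_inj -> //]]|jf]; by exists j; rewrite eqxx.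
Qed.

Definition satisfied (f : coloring) (e : nat) : bool :=
  close_pair x e && [exists c : 'I_n,
    [&& adjn x (e %/ n) c, adjn x c (e %% n)
      & color_of f (code n (e %/ n) c) != color_of f (code n (e %% n) c)]].

Definition satisfied_count (f : coloring) : nat := \sum_(e < m) satisfied f e.

Definition respects (f : coloring) (M : nat) : bool :=
  [forall e : 'I_m, selected x M e ==> ~~ satisfied f e].

(** Idempotence is proved along with the equivalence because it is used there: from invariance under
    the merged labels it recovers invariance under the previous ones. *)
Lemma labels_invariant M t : t <= m * n ->
  (forall z, z < m -> labels x M t (labels x M t z) = labels x M t z) /\
  forall f : coloring,
    (forall z, z < m -> color_of f z = color_of f (labels x M t z)) <->
    (forall i, i < t -> triple_active x M i ->
       color_of f (code n (i %/ n %/ n) (i %% n)) = color_of f (code n (i %/ n %% n) (i %% n))).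
Proof.
elim: t => [_|t IH tm]; first by split.
have [idem inv] := IH (ltnW tm); have n0 : 0 < n by case: (n) tm.
have ltm z := @label_lt x M t z (ltnW tm).
have un : t %/ n %/ n < n by rewrite !ltn_divLR.
set a := code n (t %/ n %/ n) (t %% n); set b := code n (t %/ n %% n) (t %% n).
have am : a < m by rewrite code_lt ?ltn_pmod.
have bm : b < m by rewrite code_lt ?ltn_pmod.
rewrite /= -/a -/b; case: ifP => act; last first.
  split=> // f; rewrite inv; split=> H i it; last by apply: H; apply: leqW.
  by move: it; rewrite ltnS leq_eqVlt => /orP[/eqP ->|/H //]; rewrite act.
move: (labels x M t) idem inv ltm => l idem inv ltm; split.
  move=> z zm; rewrite /merge; case: (eqVneq (l z) (l b)) => zb.
    by rewrite !idem //; case: ifP.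
  by rewrite !idem // (negPf zb).
move=> f; split=> [H|H].
  have lab z : z < m -> color_of f z = color_of f (l z).
    move=> zm; rewrite H // (H (l z)) ?ltm // /merge.
    by rewrite !idem.
  move=> i; rewrite ltnS leq_eqVlt => /orP[/eqP -> _|it]; last by apply: (inv f).1.
  rewrite -/a -/b lab // (H b) // /merge eqxx //.
have lab := (inv f).2 (fun i it => H i (leqW it)).
move=> z zm; rewrite /merge; case: eqP => zb; last exact: lab.
by rewrite lab // zb -!lab // -(H t).
Qed.

Lemma card_respects M : #|[set f : coloring | respects f M]| = 2 ^ class_count x M.
Proof.
have [idem inv] := labels_invariant M (leqnn (m * n)).
have ltm (z : 'I_m) := label_lt M (leqnn (m * n)) (ltn_ord z).
pose l z := Ordinal (ltm z).
have ll : idempotent_fun l by move=> z; apply: val_inj; apply: idem.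
have -> : class_count x M = #|[set z | l z == z]|.
  by rewrite -sum1_card [RHS]big_mkcond; apply: eq_bigr => z _; rewrite inE -val_eqE; case: eqP.
rewrite -(card_invariant_sets ll); apply: eq_card => f; rewrite !inE.
apply/forallP/forallP => [H z|H e].
  rewrite -!color_ofE /=; apply/eqP; apply: (inv f).2 => // i im /and3P[sel a1 a2].
  have n0 : 0 < n by case: (n) im.
  have em : i %/ n < m by rewrite ltn_divLR.
  have cn : i %% n < n by rewrite ltn_pmod.
  move/implyP: (H (Ordinal em)) => /(_ sel); rewrite /satisfied /=.
  have /andP[-> _] := sel; rewrite negb_exists => /forallP/(_ (Ordinal cn)) /=.
  by rewrite a1 a2 negbK => /eqP.
apply/implyP=> sel; rewrite /satisfied negb_and negb_exists; apply/orP; right.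
apply/forallP=> c; apply/negP => /and3P[a1 a2]; case/negP; apply/eqP.
have n0 : 0 < n by apply: leq_trans (ltn_ord c).
have im : e * n + c < m * n by have := ltn_ord e; have := ltn_ord c; nia.
have fl z : z < m -> color_of f z = color_of f (labels x M (m * n) z).
  by move=> zm; have := H (Ordinal zm); rewrite -!color_ofE => /eqP.
have := (inv f).1 fl (e * n + c) im.
rewrite /triple_active divnMDl // modnMDl (divn_small (ltn_ord c)) addn0 (modn_small (ltn_ord c)).
by rewrite sel a1 a2 => ->.
Qed.

Lemma pair_rankS k : pair_rank x k.+1 = pair_rank x k + close_pair x k.
Proof. by rewrite /pair_rank big_ord_recr. Qed.

Lemma pair_rank_lt e k : e < k -> close_pair x e -> pair_rank x e < pair_rank x k.
Proof.
elim: k => // k IH; rewrite ltnS leq_eqVlt pair_rankS => /orP[/eqP -> ->|ek ce].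
  by rewrite addn1.
by rewrite ltn_addr // IH.
Qed.

(** The expansion of a product of binomials: the digit of [M] at the rank of [e] selects [a e] or
    [b e]. *)
Lemma sum_over_sets (R : comNzRingType) (a b : nat -> R) k :
  (\sum_(M < 2 ^ pair_rank x k) \prod_(e < k)
     (if close_pair x e then if odd (M %/ 2 ^ pair_rank x e) then b e else a e else 1)
   = \prod_(e < k) (if close_pair x e then a e + b e else 1))%R.
Proof.
elim: k => [|k IH]; first by rewrite /pair_rank !big_ord0 big_ord1 big_ord0.
rewrite [RHS]big_ord_recr -IH /= pair_rankS; case: ifP => ck; last first.
  rewrite addn0 GRing.mulr1; apply: eq_bigr => M _.
  by rewrite big_ord_recr /= ck GRing.mulr1.
(* The range of [M] is halved by its top digit: the lower half has digit 0 at rank [r], the upper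
   half has digit 1 there and the same digits below. *)
set r := pair_rank x k; rewrite addn1 expnS mul2n -addnn GRing.mulrDr !GRing.mulr_suml.
rewrite big_split_ord /=; congr (_ + _)%R; apply: eq_bigr => M _; rewrite big_ord_recr /= ck -/r.
  by rewrite divn_small.
rewrite divnDl // divnn expn_gt0 divn_small //=; congr (_ * _)%R.
apply: eq_bigr => e _; case: ifP => // ce; have er := pair_rank_lt (ltn_ord e) ce.
rewrite -/r in er; rewrite divnDl ?dvdn_exp2l ?(ltnW er) // oddD.
by rewrite -expnB ?(ltnW er) // oddX orbF subn_eq0 leqNgt er.
Qed.

Lemma prod_bool (R : comNzRingType) k (p : 'I_k -> bool) :
  (\prod_(i < k) (p i)%:R = ([forall i, p i])%:R :> R)%R.
Proof.
case: (boolP [forall i, p i]) => [/forallP pT|].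
  by rewrite big1 // => i _; rewrite pT.
rewrite negb_forall => /existsP[i /negPf pi].
by rewrite (bigD1 i) //= pi GRing.mul0r.
Qed.

Lemma summand_prod (R : comNzRingType) (y : R) (f : coloring) M :
  (\prod_(e < m) (if close_pair x e then
      if odd (M %/ 2 ^ pair_rank x e) then (1 - y) * (~~ satisfied f e)%:R else y
    else 1)
   = y ^+ (close_count x - selected_count x M) * (1 - y) ^+ selected_count x M
     * (respects f M)%:R)%R.
Proof.
have -> : close_count x - selected_count x M = \sum_(e < m) (close_pair x e - selected x M e).
  by rewrite sumnB // => e _; rewrite /selected; case: close_pair; rewrite ?leq_b1.
rewrite -!GRing.prodrXr -prod_bool -!big_split /=; apply: eq_bigr => e _.
rewrite /selected; case: close_pair => /=; last by rewrite !GRing.expr0 !GRing.mul1r.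
by case: odd; rewrite /= ?GRing.expr0 ?GRing.expr1 ?GRing.mul1r ?GRing.mulr1.
Qed.

Lemma sieve_sum : rank_limit x = close_count x ->
  even_sum x = odd_sum x + \sum_(f : coloring) ybase x ^ satisfied_count f.
Proof.
move=> rE; pose y : int := (ybase x)%:R%R.
apply/eqP; rewrite -(Num.Theory.eqr_nat int) GRing.natrD GRing.addrC -GRing.subr_eq; apply/eqP.
rewrite !GRing.natr_sum -GRing.sumrB rE.
transitivity (\sum_(M < 2 ^ close_count x) \sum_(f : coloring)
  (y ^+ (close_count x - selected_count x M) * (1 - y) ^+ selected_count x M
     * (respects f M)%:R))%R.
  apply: eq_bigr => M _; rewrite -GRing.mulr_sumr.
  have -> : (\sum_(f : coloring) (respects f M)%:R = (2 ^ class_count x M)%:R :> int)%R.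
    rewrite -card_respects -sum1_card GRing.natr_sum [RHS]big_mkcond.
    by apply: eq_bigr => f _; rewrite inE; case: respects.
  have -> : (1 - y = -1 * (ybase x - 1)%:R)%R.
    by rewrite GRing.natrB ?expn_gt0 // GRing.mulN1r GRing.opprB.
  rewrite GRing.exprMn -GRing.signr_odd.
  by case: odd; rewrite /= /summand !GRing.natrM (GRing.natrX _ (ybase x))
    (GRing.natrX _ (ybase x - 1)) -/y; ring.
rewrite exchange_big; apply: eq_bigr => f _ /=.
under eq_bigr => M _ do rewrite -summand_prod.
rewrite (sum_over_sets (fun=> y) (fun e => (1 - y) * (~~ satisfied f e)%:R)%R).
rewrite (GRing.natrX _ (ybase x)) -/y -GRing.prodrXr; apply: eq_bigr => e _.
rewrite /satisfied; case: close_pair => //=; case: [exists _, _] => /=.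
  by rewrite GRing.mulr0 GRing.addr0 GRing.expr1.
by rewrite GRing.mulr1 GRing.expr0 GRing.subrKC.
Qed.

(** If no coloring reaches q > 0, the sum is at most 2^m y^(q - 1), which is less than y^q as y =
    2^(m + 1). *)
Lemma satisfied_count_bound :
  (exists f, q <= satisfied_count f) <->
  ybase x ^ q <= \sum_(f : coloring) ybase x ^ satisfied_count f.
Proof.
have y1 : 1 < ybase x by rewrite /ybase -{1}(expn0 2) ltn_exp2l // addn1.
split=> [[f qf]|].
  by rewrite (bigD1 f) //=; apply: leq_trans (leq_addr _ _); rewrite leq_exp2l.
move=> h; apply/existsP; apply: contraLR h; rewrite negb_exists => /forallP H; rewrite -ltnNge.
case: (posnP q) H => [->|q0] H; first by have := H set0.
apply: (@leq_ltn_trans (\sum_(f : coloring) ybase x ^ q.-1)).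
  apply: leq_sum => f _; rewrite leq_exp2l // -ltnS prednK // ltnNge; exact: H.
have := card_powerset [set: 'I_m]; rewrite powersetT !cardsT card_ord => cC.
rewrite sum_nat_const cC.
by rewrite -{2}(prednK q0) expnS ltn_mul2r expn_gt0 (ltnW y1) /= /ybase ltn_exp2l // addn1.
Qed.

Lemma close_pair_neq e (c : nat) : close_pair x e -> c < n ->
  e < m -> code n (e %/ n) c != code n (e %% n) c.
Proof.
move=> /and3P[uv _ _] cn em; have n0 : 0 < n by case: (n) em.
have un : e %/ n < n by rewrite ltn_divLR.
have vn : e %% n < n by rewrite ltn_pmod.
apply/eqP => /(congr1 (decode n)).
rewrite -[e %/ n]/(val (Ordinal un)) -[e %% n]/(val (Ordinal vn)) -[c]/(val (Ordinal cn)).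
rewrite !decode_code => /set2_eq [[/(congr1 val)]|[]] /=.
  by move: uv => /[swap] ->; rewrite ltnn.
by move=> /(congr1 val) /= uc /(congr1 val) /= cv; move: uv; rewrite uc cv ltnn.
Qed.

(** The expectation argument as a double count: each close pair is satisfied by at least half of the
    colorings. Mere existence suffices, as the program only has to answer yes. *)
Lemma many_close_pairs : 2 * q <= close_count x -> exists f, q <= satisfied_count f.
Proof.
move=> qA; apply/existsP; apply: contraLR qA; rewrite negb_exists => /forallP H; rewrite -ltnNge.
have cC : 0 < #|{set 'I_m}| by apply/card_gt0P; exists set0.
rewrite -(ltn_pmul2l cC).
have le : #|{set 'I_m}| * close_count x <= 2 * \sum_(f : coloring) satisfied_count f.
  rewrite /satisfied_count exchange_big !big_distrr /=.
  apply: leq_sum => e _; case: (boolP (close_pair x e)) => ce; rewrite ?muln0 ?muln1 //.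
  have /and3P[_ _ /existsP[c /andP[a1 a2]]] := ce.
  have n0 : 0 < n by apply: leq_trans (ltn_ord c).
  have um : code n (e %/ n) c < m by rewrite code_lt // ltn_divLR.
  have vm : code n (e %% n) c < m by rewrite code_lt // ltn_pmod.
  have uv : Ordinal um != Ordinal vm by rewrite -val_eqE /= close_pair_neq.
  apply: leq_trans (card_separating_sets uv) _; rewrite leq_mul2l /=.
  rewrite -sum1_card big_mkcond /=; apply: leq_sum => f _; rewrite inE -!color_ofE /=.
  case: ifP => // fuv; rewrite /satisfied ce lt0b /=; apply/existsP; exists c.
  by rewrite a1 a2.
apply: leq_ltn_trans le _; have q0 : 0 < q by have := H set0; rewrite -ltnNge; apply: leq_trans.
apply: (@leq_ltn_trans (2 * (#|{set 'I_m}| * q.-1))).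
  rewrite leq_mul2l /= -sum_nat_const; apply: leq_sum => f _.
  by rewrite -ltnS prednK // ltnNge; apply: H.
by rewrite mulnCA !ltn_pmul2l // prednK.
Qed.

Lemma sieveP_count : sieve x <-> exists f, q <= satisfied_count f.
Proof.
rewrite /sieve; case: (leqP (2 * q) (close_count x)) => [qA|Aq] /=.
  by split=> // _; apply: many_close_pairs.
rewrite sieve_sum; last by apply/minn_idPl/ltnW.
by rewrite leq_add2l satisfied_count_bound.
Qed.

(** With two colors a rainbow path has at most two edges, and between distinct non-adjacent vertices
    it has exactly two; so only close pairs can ever be connected. *)
Lemma satisfied_coloring (col : {set 'I_n} -> 'I_2) :
  exists f : coloring, forall uv : 'I_n * 'I_n, rainbow_pair (graph_of x) col uv ->
    satisfied f (uv.1 * n + uv.2).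
Proof.
exists [set z : 'I_m | col (decode n z) == 1%R] => -[u v] [/= uv nuv [p [pp lp up uc]] _].
have colE (a b : 'I_n) : color_of [set z : 'I_m | col (decode n z) == 1%R] (code n a b)
    = (col [set a; b] == 1%R).
  have cm := code_lt (ltn_ord a) (ltn_ord b).
  by rewrite -[code n a b]/(val (Ordinal cm)) color_ofE inE decode_code.
have sp : size p <= 2.
  have := max_card (mem (edge_colors col u p)).
  by rewrite (card_uniqP uc) size_pairmap card_ord.
have un : (u * n + v) %/ n = u by rewrite divnMDl ?divn_small ?addn0 // (leq_trans _ (ltn_ord u)).
have vn : (u * n + v) %% n = v by rewrite modnMDl modn_small.
case: p pp lp up uc sp => [|c [|d [|]]] //=.
- by move=> _ uvE; move: uv; rewrite uvE ltnn.
- by move=> /andP[uc _] cv; move: nuv; rewrite -cv uc.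
move=> /and3P[uc cd _] dv _; rewrite dv in cd *; rewrite andbT inE => neq _.
rewrite /satisfied /close_pair un vn uv adjnE nuv /=; apply/andP; split.
  by apply/existsP; exists c; rewrite !adjnE uc.
apply/existsP; exists c; rewrite !adjnE uc cd /= !colE [[set v; c]]setUC.
move: neq; case: (col [set u; c]) => -[|[|]] //= ?; case: (col [set c; v]) => -[|[|]] //= ?.
Qed.

Lemma coloring_satisfied (f : coloring) :
  exists col : {set 'I_n} -> 'I_2, forall uv : 'I_n * 'I_n,
    satisfied f (uv.1 * n + uv.2) -> rainbow_pair (graph_of x) col uv.
Proof.
exists (fun S => inord (color_of f (set_code S))) => -[u v] /=.
have un : (u * n + v) %/ n = u by rewrite divnMDl ?divn_small ?addn0 // (leq_trans _ (ltn_ord u)).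
have vn : (u * n + v) %% n = v by rewrite modnMDl modn_small.
rewrite /satisfied /close_pair un vn adjnE => /andP[/and3P[uv nuv _]].
case/existsP=> c; rewrite !adjnE => /and3P[uc cv fc].
have ncu : c != u by apply: contraTneq uc => ->; rewrite adj_irrefl.
have ncv : c != v by apply: contraTneq cv => ->; rewrite adj_irrefl.
have nuv' : u != v by rewrite -val_eqE ltn_eqF.
have neq : inord (color_of f (set_code [set u; c])) !=
    inord (color_of f (set_code [set c; v])) :> 'I_2.
  rewrite -val_eqE /= !inordK ?ltnS ?leq_b1 // !set_codeE (codeC n c v).
  by move: fc; do 2!case: color_of.
split=> //=.
- exists [:: c; v]; split=> //=; first by rewrite uc cv.
    by rewrite !inE (eq_sym u c) (negPf ncu) (negPf nuv') ncv.
  by rewrite inE neq.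
- exists [:: c; u]; split=> //=; first by rewrite (adj_sym _ v c) cv (adj_sym _ c u) uc.
    by rewrite !inE (eq_sym v c) (negPf ncv) (eq_sym v u) (negPf nuv') ncu.
  by rewrite inE (setUC [set v]) (setUC [set c] [set u]) eq_sym neq.
Qed.

Lemma sieveP : reflect (has_rainbow_coloring 2 x) (sieve x).
Proof.
apply: (iffP idP) => [/sieveP_count[f qf]|/has_rainbowP[col [R [qR RP]]]].
  have [col colP] := coloring_satisfied f; apply/has_rainbowP.
  exists col, [set uv : 'I_n * 'I_n | satisfied f (uv.1 * n + uv.2)]; split; last first.
    by move=> uv; rewrite inE; apply: colP.
  rewrite -demand_le; apply: leq_trans qf _.
  rewrite /satisfied_count (pair_sum n (satisfied f)) pair_big /= -sum1_card [leqRHS]big_mkcond /=.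
  by apply: leq_sum => uv _; rewrite inE; case: ifP.
have [f fP] := satisfied_coloring col.
apply/sieveP_count; exists f; move: qR; rewrite -demand_le => /leq_trans; apply.
rewrite /satisfied_count (pair_sum n (satisfied f)) pair_big /= -sum1_card [leqLHS]big_mkcond /=.
by apply: leq_sum => uv _; case: ifP => // /RP/fP ->.
Qed.

End Sieve.

(** * Resource bounds *)

(** An explicit coefficient makes closure under sums and products immediate; [poly_boundedW]
    converts to the form [a ^ c + c] of the statement. *)
Definition poly_bounded (f : nat -> nat) : Prop :=
  exists c d, forall a, f a <= c * (a + 1) ^ d.

Lemma poly_const c : poly_bounded (fun=> c).
Proof. by exists c, 0 => a; rewrite muln1. Qed.

Lemma poly_id : poly_bounded id.
Proof. by exists 1, 1 => a; rewrite mul1n expn1 leq_addr. Qed.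

Lemma poly_add f g : poly_bounded f -> poly_bounded g -> poly_bounded (fun a => f a + g a).
Proof.
move=> [c [d fP]] [c' [d' gP]]; exists (c + c'), (d + d') => a.
rewrite mulnDl; apply: leq_add; [apply: leq_trans (fP a) _|apply: leq_trans (gP a) _];
  by rewrite leq_mul2l leq_pexp2l ?orbT ?addn1 ?leq_addr ?leq_addl.
Qed.

Lemma poly_mul f g : poly_bounded f -> poly_bounded g -> poly_bounded (fun a => f a * g a).
Proof.
move=> [c [d fP]] [c' [d' gP]]; exists (c * c'), (d + d') => a.
by rewrite expnD mulnACA leq_mul.
Qed.

Lemma poly_exp f e : poly_bounded f -> poly_bounded (fun a => f a ^ e).
Proof.
move=> pf; elim: e => [|e IH]; first exact: poly_const.
have [c [d H]] := poly_mul pf IH; exists c, d => a; rewrite expnS; exact: H.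
Qed.

Lemma poly_boundedW f : poly_bounded f -> polynomially_bounded f.
Proof.
(* For a >= 2, (a + 1)^d <= a^(2d) and c <= a^c account for the exponent [2 * d + c]; the arguments
   0 and 1 are covered by the additive constant, which exceeds [c * 2 ^ d]. *)
move=> [c [d fP]]; exists (2 * d + c + c * 2 ^ d) => a; apply: leq_trans (fP a) _.
case: a => [|[|a]].
- by apply: leq_trans (leq_addl _ _); rewrite exp1n muln1; lia.
- by apply: leq_trans (leq_addl _ _); rewrite addn1; lia.
apply: leq_trans (leq_addr _ _).
rewrite -addnA expnD mulnC leq_mul //.
  by rewrite expnM leq_expl // -mulnn; nia.
apply: (@leq_trans (2 ^ c)); first exact/ltnW/ltn_expl.
apply: (@leq_trans (a.+2 ^ c)); first exact: leq_expl.
by rewrite leq_pexp2l // leq_addr.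
Qed.

Ltac poly := repeat first
  [ exact: poly_const | exact: poly_id | apply: poly_add | apply: poly_mul | apply: poly_exp ].

(** Registers must be able to hold the target, so every time bound has a factor [bitlen q ^ 2]. It
    is absorbed here at the price of [2 ^ q], which for two colors raises 4^q to 8^q. *)
Lemma bitlen_sq q : bitlen q ^ 2 <= 4 * 2 ^ q.
Proof.
rewrite /bitlen; case: (posnP q) => [->|q0]; first by rewrite trunc_log0.
have tq := trunc_logP (isT : 1 < 2) q0; set t := trunc_log 2 q in tq *.
have tt : 2 * t <= 2 ^ t + 1.
  elim: (t) => // [[|[|u]]] // IH; have := ltn_expl u (isT : 1 < 2).
  by move: IH; rewrite !expnS; lia.
apply: (@leq_trans (2 ^ (2 * t))).
  by rewrite mulnC expnM leq_exp2r // ltn_expl.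
apply: (@leq_trans (2 ^ (q + 2))); last by rewrite expnD mulnC.
by rewrite leq_exp2l //; lia.
Qed.

(** The s-th power of x <= s (x div s + 1) <= s 2^(x div s). *)
Lemma expn_le_factor x s : x ^ s <= s ^ s * 2 ^ x.
Proof.
case: (posnP s) => [->|s0]; first by rewrite !expn0 mul1n expn_gt0.
apply: (@leq_trans ((s * 2 ^ (x %/ s)) ^ s)).
  apply: leq_expl; have := ltn_expl (x %/ s) (isT : 1 < 2).
  have := divn_eq x s; have := ltn_pmod x s0; nia.
rewrite expnMn -expnM leq_mul2l leq_exp2l //.
by rewrite leq_divM orbT.
Qed.

Lemma hash_family_size k x : 0 < k ->
  hash_base k x ^ edge_bound k x <=
    2 ^ (26 * k ^ 2 * (target x * bitlen (target x))) * (4 * (order_of x + 1)).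
Proof.
move=> k0; set s := edge_bound k x; set q := target x; set l := bitlen q.
set U := up_log 2 (order_of x).
have sq : s <= 2 * k * q by rewrite leq_mul2l geq_minl orbT.
have l0 : 0 < l by [].
have ql : q + 1 <= 2 ^ l by rewrite addn1 ltn_bitlen.
have kl : 2 * k + 1 <= 2 ^ (2 * k) by rewrite addn1 ltn_expl.
have s1 : s + 1 <= 2 ^ (2 * k + l).
  by rewrite expnD; apply: leq_trans (leq_mul kl ql); nia.
have U2 : 2 ^ (U + 1) <= 4 * (order_of x + 1).
  rewrite addn1 expnS; case: (ltnP 1 (order_of x)) => n1.
    have := up_log_gtn (isT : 1 < 2) n1; have : 0 < U by rewrite up_log_gt0 n1.
    by rewrite -/U; case: (U) => // u _; rewrite expnS /=; lia.
  have -> : U = 0 by apply/eqP; rewrite up_log_eq0 n1 orbT.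
  by rewrite expn0; lia.
have B1 : hash_base k x <= 2 ^ (4 * k) * ((U + 1) * (s + 1) ^ 2).
  apply: (@leq_trans (4 * k * ((U + 1) * (s + 1) ^ 2))).
    rewrite /hash_base /modulus_bound -/s -/U.
    rewrite (_ : _ * _ * _ = (4 * ((U + 1) * (s + 1) ^ 2)) * k); last by lia.
    by rewrite leq_mul2r; apply/orP; right; nia.
  by apply: leq_mul => //; apply/ltnW/ltn_expl.
apply: leq_trans (leq_expl s B1) _; rewrite expnMn (expnMn (U + 1)) -!expnM.
apply: (@leq_trans (2 ^ (4 * k * s) * (((s + 1) ^ s * 2 ^ (U + 1)) * (s + 1) ^ (2 * s)))).
  rewrite leq_mul2l; apply/orP; right; rewrite leq_mul2r; apply/orP; right.
  apply: leq_trans (expn_le_factor _ _) _; rewrite leq_mul2r; apply/orP; right.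
  by apply: leq_expl; rewrite leq_addr.
rewrite (mulnAC ((s + 1) ^ s)) mulnA leq_mul //.
rewrite -expnD (_ : s + 2 * s = 3 * s); last by lia.
apply: (@leq_trans (2 ^ (4 * k * s) * (2 ^ (2 * k + l)) ^ (3 * s))).
  by rewrite leq_mul2l leq_expl ?orbT.
rewrite -expnM -expnD leq_exp2l //.
(* The exponent is 4ks + 3s(2k + l) = s(10k + 3l) <= 13kls, and s <= 2kq turns 13 into 26. *)
apply: (@leq_trans (s * (13 * k * l))); first by nia.
by apply: leq_trans (leq_mul sq (leqnn _)) _; rewrite -mulnn; nia.
Qed.

Lemma size_encode x : size (encode_rainbow x) = order_of x * order_of x + 2.
Proof. by rewrite /= size_allpairs !size_enum_ord addn2. Qed.

Lemma encode_lt x W : order_of x <= W ->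
  all (fun a => a < 2 ^ (bitlen (target x) + W)) (encode_rainbow x).
Proof.
move=> nW; have W2 : 2 ^ W <= 2 ^ (bitlen (target x) + W) by rewrite leq_exp2l // leq_addl.
apply/and3P; split.
- by apply: leq_trans W2; apply: leq_ltn_trans nW _; apply: ltn_expl.
- by apply: leq_trans (ltn_bitlen _) _; rewrite leq_exp2l // leq_addr.
- by apply/allP=> _ /allpairsP[uv [_ _ ->]]; apply: leq_ltn_trans (leq_b1 _) _;
    rewrite -{1}(expn0 2) ltn_exp2l // addn_gt0.
Qed.

Lemma order_le_input_size k (x : rainbow_instance) :
  order_of x + 1 < input_size (A := max_rainbow_coloring k) x.
Proof.
apply: (@leq_trans (size (encode_rainbow x))).
  by rewrite size_encode; case: (order_of x) => // n; nia.
change (size (encode_rainbow x) <= \sum_(a <- encode_rainbow x) bitlen a).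
by elim: (encode_rainbow x) => //= a r IH; rewrite big_cons -add1n leq_add.
Qed.

Lemma target_le_input_size k (x : rainbow_instance) :
  bitlen (target x) <= input_size (A := max_rainbow_coloring k) x.
Proof. by rewrite /input_size /= !big_cons addnCA leq_addr. Qed.

(** * Running times of the compiled programs *)

Lemma term_bounds (a : term) (ans : rainbow_instance -> bool)
    (Lf Wf : nat -> nat) (Tf : rainbow_instance -> nat) :
  poly_bounded Lf -> poly_bounded Wf -> (forall n, 0 < Lf n) ->
  (forall n, n <= Wf n) -> (forall x, 0 < Tf x) ->
  (forall M x, input M = encode_rainbow x ->
     width M = bitlen (target x) + Wf (order_of x) ->
     small_limit M = Lf (order_of x) -> big_limit M = Tf x ->
     comp M true [::] a (ans x)) ->
  exists K D, forall x, exists t m s,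
    [/\ exec (a 0) (start (encode_rainbow x)) t m s, output s = ans x,
        t <= Tf x * bitlen (target x) ^ 2 * (K * (order_of x + 1) ^ D)
      & m <= bitlen (target x) * (K * (order_of x + 1) ^ D)].
Proof.
move=> pL pW L0 nW T0 H; set c := a 0.
have pt : poly_bounded (fun n =>
    com_size c * Lf n ^ com_depth c * (1 + Wf n) ^ 2
    + (1 + Wf n) * (reg_count c + (n * n + 2))) by poly.
have [K [D KD]] := pt; exists K, D => x; set n := order_of x.
have W0 : 0 < bitlen (target x) + Wf n by [].
pose M := Machine (Lf n) (Tf x) W0 (encode_lt (nW (order_of x))).
have [t [m [s [ex out le_t le_m]]]] := comp_exec (H M x erefl erefl erefl erefl).
(* The width is a sum; bounding it by a product separates the target from n in the final
   estimate. *)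
have wE : bitlen (target x) + Wf n <= bitlen (target x) * (1 + Wf n).
  by rewrite mulnDr muln1 leq_add2l leq_pmull.
exists t, m, s; split=> //.
- apply: leq_trans le_t _; have := com_cost_le true c (L0 n) (T0 x).
  move: (KD n); set A := com_size c * _; set V := (1 + Wf n) * _ => le1 le2.
  apply: (@leq_trans (A * Tf x * (bitlen (target x) * (1 + Wf n)) ^ 2)).
    by rewrite leq_mul // leq_expl.
  rewrite expnMn (_ : _ * _ * (_ * _) =
    Tf x * bitlen (target x) ^ 2 * (A * (1 + Wf n) ^ 2)); last by ring.
  by rewrite leq_mul2l (leq_trans (leq_addr V _)) ?orbT.
- apply: leq_trans le_m _; rewrite size_encode.
  apply: leq_trans (leq_mul wE (leqnn _)) _; rewrite -mulnA leq_mul2l.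
  by apply/orP; right; apply: leq_trans (KD n); apply: leq_addl.
Qed.

(** The sum of all lower bounds that [comp_hash_search] puts on the small limit, with the demand
    replaced by n^2 + 1 and the logarithm by n. *)
Definition hash_small (k n : nat) : nat :=
  let s := 2 * k * (n * n + 1) in
  n * n + n + 4 + (s + s * s + 2 * k) + ((4 * (n * (s * s)) + 2) * k + 1).

Lemma hash_bounds k : 0 < k ->
  exists K D, forall x, exists t m s,
    [/\ exec (hash_searchT k 0) (start (encode_rainbow x)) t m s,
        output s = hash_search k x,
        t <= 2 ^ (26 * k ^ 2 * (target x * bitlen (target x)) + target x)
             * (K * (order_of x + 1) ^ D)
      & m <= bitlen (target x) * (K * (order_of x + 1) ^ D)].
Proof.
(* The square in [Wf] makes room for the number of tables: B^s <= 2^(B s), where both B and s are at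
   most [Lf n]. *)
move=> k0; pose Lf := hash_small k; pose Wf n := Lf n * Lf n + Lf n.
have pL : poly_bounded Lf by rewrite /Lf /hash_small; poly.
have [|||||K [D KD]] := @term_bounds (hash_searchT k) (hash_search k) Lf Wf
  (fun x => hash_base k x ^ edge_bound k x) pL.
- by rewrite /Wf; poly.
- by move=> n; rewrite /Lf /hash_small; lia.
- by move=> n; rewrite /Wf /Lf /hash_small; lia.
- by move=> x; rewrite expn_gt0 base_gt0.
- move=> M x iE wE sE bE.
  have sL : edge_bound k x <= 2 * k * (order_of x * order_of x + 1).
    by rewrite leq_mul2l geq_minr orbT.
  have uL : up_log 2 (order_of x) <= order_of x.
    by apply: up_log_min => //; apply/ltnW/ltn_expl.
  have ssL := leq_mul sL sL.
  have BL : hash_base k x <= (4 * (order_of x * ((2 * k * (order_of x * order_of x + 1))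
      * (2 * k * (order_of x * order_of x + 1)))) + 2) * k.
    by rewrite leq_mul2r leq_add2r leq_mul2l leq_mul ?orbT.
  have LE : Lf (order_of x) = order_of x * order_of x + order_of x + 4
      + (2 * k * (order_of x * order_of x + 1)
         + 2 * k * (order_of x * order_of x + 1) * (2 * k * (order_of x * order_of x + 1))
         + 2 * k)
      + ((4 * (order_of x * ((2 * k * (order_of x * order_of x + 1))
           * (2 * k * (order_of x * order_of x + 1)))) + 2) * k + 1) by [].
  have pB : hash_base k x ^ edge_bound k x < 2 ^ width M.
    apply: (@leq_ltn_trans (2 ^ (hash_base k x * edge_bound k x))).
      by rewrite expnM leq_expl // ltnW // ltn_expl.
    rewrite ltn_exp2l // wE /Wf.
    have : hash_base k x * edge_bound k x <= Lf (order_of x) * Lf (order_of x).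
      by apply: leq_mul; rewrite LE; lia.
    by rewrite /bitlen; lia.
  apply: comp_hash_search => //; rewrite ?sE ?bE ?wE ?LE; try lia.
  + rewrite -LE; apply: leq_trans (ltn_expl _ (isT : 1 < 2)) _.
    by rewrite leq_exp2l // /Wf; lia.
  + by rewrite ltn_exp2l // /Wf LE /bitlen; lia.
(* One factor 4 comes from [bitlen_sq], and [4 * (n + 1)] from [hash_family_size]. *)
exists (16 * K), D.+1 => x; have [t [m [s [ex out le_t le_m]]]] := KD x.
exists t, m, s; split=> //.
  apply: leq_trans le_t _; have := hash_family_size x k0; have := bitlen_sq (target x).
  set z := order_of x + 1; set F := _ ^ edge_bound k x; set G := 2 ^ (26 * _ * _) => le1 le2.
  apply: leq_trans (leq_mul (leq_mul le2 le1) (leqnn _)) _.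
  by rewrite expnD -/G expnS; apply: eq_leq; ring.
apply: leq_trans le_m _; rewrite leq_mul2l; apply/orP; right.
by rewrite expnS; apply: leq_mul; [lia|rewrite leq_pmull // addn1].
Qed.

Lemma sieve_bounds :
  exists K D, forall x, exists t m s,
    [/\ exec (sieveT 0) (start (encode_rainbow x)) t m s, output s = sieve x
      & t <= 8 ^ target x * (K * (order_of x + 1) ^ D)].
Proof.
pose Lf n := n * n * n + 3 * (n * n) + n + 4.
pose Wf n := (n * n + 3) * (n * n + 3) + Lf n.
have [||||||K [D KD]] := @term_bounds sieveT sieve Lf Wf (fun x => 2 ^ rank_limit x).
- by rewrite /Lf; poly.
- by rewrite /Wf /Lf; poly.
- by move=> n; rewrite /Lf addn4.
- by move=> n; rewrite /Wf /Lf; lia.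
- by move=> x; rewrite expn_gt0.
- move=> M x iE wE sE bE; apply: comp_sieve => //; rewrite ?sE ?bE ?wE.
  + apply: leq_trans (ltn_expl _ (isT : 1 < 2)) _.
    by rewrite leq_exp2l // /Wf; lia.
  + by rewrite /Lf; lia.
  + by rewrite /Lf; lia.
  + by rewrite /Wf; lia.
  + by [].
exists (4 * K), D => x; have [t [m [s [ex out le_t _]]]] := KD x.
exists t, m, s; split=> //; apply: leq_trans le_t _.
have h : 2 ^ rank_limit x <= 4 ^ target x.
  rewrite -[4]/(2 ^ 2) -expnM leq_exp2l //; apply: leq_trans (geq_minr _ _) _.
  by rewrite leq_mul2l geq_minl.
apply: leq_trans (leq_mul (leq_mul h (bitlen_sq _)) (leqnn _)) _.
by rewrite -[8]/(4 * 2) expnMn; apply: eq_leq; ring.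
Qed.

(** Fixed-parameter tractability requires a computable bound; [q * (q + 1)] stands in for
    [q * bitlen q] so that the witness needs no logarithm. *)
Lemma computable_exp K G : computable (fun q => K * 2 ^ (G * (q * (q + 1)))).
Proof.
pose qT := load (cst 0).
exists (op Mul (cst K) (powT (cst 2)
  (op Mul (cst G) (op Mul qT (op Add qT (cst 1))))) 0) => q.
(* Width and loop limit may depend on [q], since they belong to the analysis while the program is
   fixed. *)
pose e := G * (q * (q + 1)); pose W := K + G + q * (q + 1) + e + 2.
have W0 : 0 < W by rewrite /W addn2.
have small v : v <= W -> v < 2 ^ W by move=> vW; apply: leq_ltn_trans vW (ltn_expl _ _).
have qW : all (fun a => a < 2 ^ W) [:: q] by rewrite /= andbT small // /W; nia.
pose M := Machine e 0 W0 qW.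
have cq : comp M false [::] qT q by apply: (comp_load (M := M)) (comp_zero _ _ _).
have c2 : comp M false [::] (cst 2) 2 by apply: comp_cst; apply: small; rewrite /W; lia.
have ce : comp M false [::] (op Mul (cst G) (op Mul qT (op Add qT (cst 1)))) e.
  apply: comp_mul; [by apply: comp_cst; apply: small; rewrite /W; lia| |
    by apply: small; rewrite /W; lia].
  apply: comp_mul => //; last by apply: small; rewrite /W; lia.
  by apply: comp_add => //; [exact: comp_one|apply: small; rewrite /W; nia].
have eW : 2 ^ e < 2 ^ W by rewrite ltn_exp2l // /W; lia.
have cK : comp M false [::] (op Mul (cst K) (powT (cst 2)
    (op Mul (cst G) (op Mul qT (op Add qT (cst 1)))))) (K * 2 ^ e).
  apply: comp_mul; [by apply: comp_cst; apply: small; rewrite /W; lia|exact: comp_pow|].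
  apply: (@leq_ltn_trans (2 ^ (K + e))); last by rewrite ltn_exp2l //= /W; lia.
  by rewrite expnD; apply: leq_mul => //; apply/ltnW/ltn_expl.
by have [t [m [s [ex out _ _]]]] := comp_exec cK; exists t, m, s.
Qed.

Theorem theorem7 :
  (forall k : nat, 2 <= k ->
     fixed_parameter_tractable (max_rainbow_coloring k) /\
     exists (P : com) (g p s : nat -> nat),
       [/\ is_bigO g (fun q => q * trunc_log 2 q),
           polynomially_bounded p,
           polynomially_bounded s
         & solves_within (A := max_rainbow_coloring k) P
             (fun x t m =>
                t <= 2 ^ g (target x) * p (order_of x) /\
                m <= s (input_size x))]) /\
  (exists (P : com) (p : nat -> nat),
     polynomially_bounded p /\
     solves_within (A := max_rainbow_coloring 2) P
       (fun x t _ => t <= 8 ^ target x * p (order_of x))).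
Proof.
have outE (p : bool) s : output s = p -> output s <> 0 <-> p by move=> ->; case: p.
split=> [k k2|]; last first.
  have [K [D KD]] := sieve_bounds; exists (sieveT 0), (fun n => K * (n + 1) ^ D); split.
    by apply: poly_boundedW; poly.
  move=> x; have [t [m [s [ex out le_t]]]] := KD x; exists t, m, s; split=> //=.
  by rewrite (outE _ _ out); split=> /sieveP.
have k0 : 0 < k by apply: leq_trans k2.
have [K [D KD]] := hash_bounds k0; set P := hash_searchT k 0 in KD.
pose C := 26 * k ^ 2; pose g q := C * (q * bitlen q) + q.
have solve x : exists t m s, [/\ exec P (start (encode_rainbow x)) t m s,
    output s <> 0 <-> has_rainbow_coloring k x
    & t <= 2 ^ g (target x) * (K * (order_of x + 1) ^ D) /\
      m <= bitlen (target x) * (K * (order_of x + 1) ^ D)].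
  have [t [m [s [ex out le_t le_m]]]] := KD x; exists t, m, s; split=> //.
  by rewrite (outE _ _ out); split=> /(hash_searchP _ k0).
split.
  exists P, (fun q => K * 2 ^ (C.+1 * (q * (q + 1)))), D; split; first exact: computable_exp.
  move=> x; have [t [m [s [ex out [le_t _]]]]] := solve x; exists t, m, s; split=> //=.
  apply: leq_trans le_t _; rewrite mulnCA mulnA leq_mul //; last first.
    by apply/leq_expl/ltnW/order_le_input_size.
  rewrite leq_mul2l leq_exp2l // /g.
  have : bitlen (target x) <= target x + 1.
    by rewrite bitlen_le ?addn1 // ltnW // ltn_expl.
  by move=> h; apply/orP; right; nia.
exists P, g, (fun n => K * (n + 1) ^ D), (fun z => z * (K * (z + 1) ^ D)); split.
(* For q >= 2 the logarithm l is positive, so [bitlen q] = l + 1 <= 2l and the extra summand [q] is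
   at most q l. *)
- exists (2 * C + 1), 2 => q q2; rewrite /g /bitlen.
  have : 0 < trunc_log 2 q by rewrite trunc_log_gt0.
  by set l := trunc_log 2 q => l0; nia.
- by apply: poly_boundedW; poly.
- by apply: poly_boundedW; poly.
move=> x; have [t [m [s [ex out [le_t le_m]]]]] := solve x; exists t, m, s; split=> //; split=> //.
apply: leq_trans le_m _; apply: leq_mul; first exact: target_le_input_size.
rewrite leq_mul2l; apply/orP; right; apply: leq_expl; rewrite leq_add2r.
by apply: leq_trans (ltnW (order_le_input_size k x)); apply: leq_addr.
Qed.
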